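(* Let $k$ be an algebraically closed field of positive characteristic $p$, and let $\sigma : \mathrm{SL}(2,k) \to \mathrm{SL}(4,k)$ be a homomorphism of algebraic groups over $k$. Then there exists a homomorphism $\sigma^* : \mathrm{SL}(2,k) \to \mathrm{SL}(4,k)$ such that (i) $\sigma$ and $\sigma^*$ are equivalent; (ii) $\sigma^*$ has one of the forms $(\mathrm{I})^*$, $(\mathrm{II})^*$, $(\mathrm{IV})^*$, $(\mathrm{V})^*$, $(\mathrm{VII})^*$, $(\mathrm{IX})^*$, $(\mathrm{XI})^*$, $(\mathrm{XV})^*$, $(\mathrm{XIX})^*$, $(\mathrm{XXIV})^*$, $(\mathrm{XXVI})^*$.
   Context: Two homomorphisms $\sigma_1,\sigma_2 : \mathrm{SL}(2,k)\to \mathrm{SL}(n,k)$ are equivalent if there is $P\in \mathrm{GL}(n,k)$ with $P^{-1}\sigma_1(A)P=\sigma_2(A)$ for all $A\in \mathrm{SL}(2,k)$. The forms are the following maps (each form is available only in the indicated characteristics); $\sigma^*$ is evaluated at $\begin{pmatrix} a&b\\c&d\end{pmatrix}\in \mathrm{SL}(2,k)$. $(\mathrm{I})^*$: $p\ge 5$, $e_1\ge 0$ an integer, $q=p^{e_1}$: $$\begin{pmatrix} a^{3q} & a^{2q}b^{q} & \frac12 a^{q}b^{2q} & \frac16 b^{3q}\\ 3a^{2q}c^{q} & a^{q}(ad+2bc)^{q} & b^{q}(ad+\frac12 bc)^{q} & \frac12 b^{2q}d^{q}\\ 6a^{q}c^{2q} & 4c^{q}(ad+\frac12 bc)^{q}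 & d^{q}(ad+2bc)^{q} & b^{q}d^{2q}\\ 6c^{3q} & 6c^{2q}d^{q} & 3c^{q}d^{2q} & d^{3q}\end{pmatrix}.$$ $(\mathrm{II})^*$: $p=3$, $e_1\ge 0$, $q=p^{e_1}$: $$\begin{pmatrix} a^{pq} & a^{2q}b^{q} & \frac12 a^{q}b^{2q} & b^{pq}\\ 0 & a^{q} & b^{q} & 0\\ 0 & c^{q} & d^{q} & 0\\ c^{pq} & c^{2q}d^{q} & \frac12 c^{q}d^{2q} & d^{pq}\end{pmatrix}.$$ $(\mathrm{IV})^*$: any $p$, integers $e_2>e_1\ge 0$, $q=p^{e_1}$, $r=p^{e_2}$: $$\begin{pmatrix} a^{r}a^{q} & a^{r}b^{q} & b^{r}a^{q} & b^{r}b^{q}\\ a^{r}c^{q} & a^{r}d^{q} & b^{r}c^{q} & b^{r}d^{q}\\ c^{r}a^{q} & c^{r}b^{q} & d^{r}a^{q} & d^{r}b^{q}\\ c^{r}c^{q} & c^{r}d^{q} & d^{r}c^{q} & d^{r}d^{q}\end{pmatrix}.$$ $(\mathrm{V})^*$: $p=2$, $e_1\ge 0$, $q=p^{e_1}$: $$\begin{pmatrix} a^{2q} & a^{q}b^{q} & 0 & b^{2q}\\ 0&1&0&0\\ a^{q}c^{q} & b^{q}c^{q} & 1 & b^{q}d^{q}\\ c^{2q} & c^{q}d^{q} & 0 & d^{2q}\end{pmatrix}.$$ $(\mathrm{VII})^*$: $p=3$, $e_1\ge 0$, $q=p^{e_1}$: $$\begin{pmatrix} a^{pq} & 0&0& b^{pq}\\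 \frac12 a^{2q}c^{q} & a^{q} & b^{q} & \frac12 b^{2q}d^{q}\\ a^{q}c^{2q} & c^{q} & d^{q} & b^{q}d^{2q}\\ c^{pq}&0&0&d^{pq}\end{pmatrix}.$$ $(\mathrm{IX})^*$: $p\ge 3$, $e_1\ge 0$, $q=p^{e_1}$: $$\begin{pmatrix} a^{2q} & a^{q}b^{q} & 0 & \frac12 b^{2q}\\ 2a^{q}c^{q} & a^{q}d^{q}+b^{q}c^{q} & 0 & b^{q}d^{q}\\ 0&0&1&0\\ 2c^{2q} & 2c^{q}d^{q} & 0 & d^{2q}\end{pmatrix}.$$ $(\mathrm{XI})^*$: $p=2$, $e_1\ge 0$, $q=p^{e_1}$: $$\begin{pmatrix} a^{2q} & a^{q}b^{q} & 0 & b^{2q}\\ 0&1&0&0\\ 0&0&1&0\\ c^{2q} & c^{q}d^{q} & 0 & d^{2q}\end{pmatrix}.$$ $(\mathrm{XV})^*$: any $p$, integers $e_2\ge e_3\ge 0$, $r=p^{e_2}$, $s=p^{e_3}$: $$\begin{pmatrix} a^{r}&0&0&b^{r}\\ 0&a^{s}&b^{s}&0\\ 0&c^{s}&d^{s}&0\\ c^{r}&0&0&d^{r}\end{pmatrix}.$$ $(\mathrm{XIX})^*$: $p=2$, $e_1\ge 0$, $q=p^{e_1}$: $$\begin{pmatrix} a^{2q}&0&0&b^{2q}\\ 0&1&0&0\\ a^{q}c^{q}&0&1&b^{q}d^{q}\\ c^{2q}&0&0&d^{2q}\end{pmatrix}.$$ $(\mathrm{XXIV})^*$: any $p$, $e_2\ge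 0$, $r=p^{e_2}$: $$\begin{pmatrix} a^{r}&0&0&b^{r}\\ 0&1&0&0\\ 0&0&1&0\\ c^{r}&0&0&d^{r}\end{pmatrix}.$$ $(\mathrm{XXVI})^*$: any $p$: the constant map $I_4$. *)

(* Defs.v *)
From HB Require Import structures.
From mathcomp Require Import all_boot all_order all_fingroup all_algebra.
From mathcomp Require Import mpoly.

Set Implicit Arguments.
Unset Strict Implicit.
Unset Printing Implicit Defensive.

Import GRing.Theory.
Local Open Scope ring_scope.

Record SL (n : nat) (k : fieldType) :=
  MkSL { slval :> 'M[k]_n; slvalP : \det slval == 1 }.

HB.instance Definition _ n k := [isSub for @slval n k].
HB.instance Definition _ n k := [Choice of SL n k by <:].

Section SLGroup.
Variables (n : nat) (k : fieldType).
Implicit Types A B : SL n k.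

Fact sl_one_subproof : \det (1%:M : 'M[k]_n) == 1.
Proof. by rewrite det1. Qed.

Fact sl_mul_subproof A B : \det (slval A *m slval B) == 1.
Proof. by rewrite det_mulmx !(eqP (slvalP _)) mulr1. Qed.

Fact sl_inv_subproof A : \det (invmx (slval A)) == 1.
Proof. by rewrite det_inv (eqP (slvalP A)) invr1. Qed.

Definition sl_one : SL n k := MkSL sl_one_subproof.
Definition sl_mul A B : SL n k := MkSL (sl_mul_subproof A B).
Definition sl_inv A : SL n k := MkSL (sl_inv_subproof A).

Fact sl_unitmx A : slval A \in unitmx.
Proof. by rewrite unitmxE (eqP (slvalP A)) unitr1. Qed.

Fact sl_mulA : associative sl_mul.
Proof. by move=> A B C; apply: val_inj; rewrite /= mulmxA. Qed.

Fact sl_mul1 : left_id sl_one sl_mul.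
Proof. by move=> A; apply: val_inj; rewrite /= mul1mx. Qed.

Fact sl_1mul : right_id sl_one sl_mul.
Proof. by move=> A; apply: val_inj; rewrite /= mulmx1. Qed.

Fact sl_mulV : left_inverse sl_one sl_inv sl_mul.
Proof. by move=> A; apply: val_inj; rewrite /= mulVmx ?sl_unitmx. Qed.

Fact sl_Vmul : right_inverse sl_one sl_inv sl_mul.
Proof. by move=> A; apply: val_inj; rewrite /= mulmxV ?sl_unitmx. Qed.

End SLGroup.

HB.instance Definition _ n k := isGroup.Build (SL n k)
  (@sl_mulA n k) (@sl_mul1 n k) (@sl_1mul n k) (@sl_mulV n k) (@sl_Vmul n k).

(* SL(n, k) is closed in the affine space of n x n matrices, so a morphism of
   varieties SL(n, k) -> SL(m, k) is a map whose m ^ 2 coordinates are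
   restrictions of polynomials in the n ^ 2 matrix entries. *)
Definition regular_map (n m : nat) (k : fieldType) (s : SL n k -> SL m k) :=
  exists P : 'M[{mpoly k[n * n]}]_m,
    forall (A : SL n k) (i j : 'I_m), s A i j = (P i j).@[mxvec A 0].

Definition algebraic_group_hom (n m : nat) (k : fieldType)
    (s : SL n k -> SL m k) :=
  {morph s : A B / (A * B)%g} /\ regular_map s.

Definition equivalent (n : nat) (k : fieldType) (s1 s2 : SL 2 k -> SL n k) :=
  exists2 P : 'M[k]_n, P \in unitmx &
    forall A : SL 2 k, invmx P *m s1 A *m P = s2 A.

Section Forms.
Variable k : fieldType.

Definition mx4 (rows : seq (seq k)) : 'M[k]_4 :=
  \matrix_(i, j) nth 0 (nth [::] rows i) j.

Definition given_by (s : SL 2 k -> SL 4 k) (F : k -> k -> k -> k -> 'M[k]_4) :=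
  forall A : SL 2 k, slval (s A) = F (A 0 0) (A 0 1) (A 1 0) (A 1 1).

Definition formI (q : nat) (a b c d : k) := mx4
  [:: [:: a ^+ (3 * q);
          a ^+ (2 * q) * b ^+ q;
          2^-1 * a ^+ q * b ^+ (2 * q);
          6^-1 * b ^+ (3 * q)];
      [:: 3 * a ^+ (2 * q) * c ^+ q;
          a ^+ q * (a * d + 2 * b * c) ^+ q;
          b ^+ q * (a * d + 2^-1 * b * c) ^+ q;
          2^-1 * b ^+ (2 * q) * d ^+ q];
      [:: 6 * a ^+ q * c ^+ (2 * q);
          4 * c ^+ q * (a * d + 2^-1 * b * c) ^+ q;
          d ^+ q * (a * d + 2 * b * c) ^+ q;
          b ^+ q * d ^+ (2 * q)];
      [:: 6 * c ^+ (3 * q);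
          6 * c ^+ (2 * q) * d ^+ q;
          3 * c ^+ q * d ^+ (2 * q);
          d ^+ (3 * q)]].

Definition formII (p q : nat) (a b c d : k) := mx4
  [:: [:: a ^+ (p * q); a ^+ (2 * q) * b ^+ q;
          2^-1 * a ^+ q * b ^+ (2 * q); b ^+ (p * q)];
      [:: 0; a ^+ q; b ^+ q; 0];
      [:: 0; c ^+ q; d ^+ q; 0];
      [:: c ^+ (p * q); c ^+ (2 * q) * d ^+ q;
          2^-1 * c ^+ q * d ^+ (2 * q); d ^+ (p * q)]].

Definition formIV (q r : nat) (a b c d : k) := mx4
  [:: [:: a ^+ r * a ^+ q; a ^+ r * b ^+ q; b ^+ r * a ^+ q; b ^+ r * b ^+ q];
      [:: a ^+ r * c ^+ q; a ^+ r * d ^+ q; b ^+ r * c ^+ q; b ^+ r * d ^+ q];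
      [:: c ^+ r * a ^+ q; c ^+ r * b ^+ q; d ^+ r * a ^+ q; d ^+ r * b ^+ q];
      [:: c ^+ r * c ^+ q; c ^+ r * d ^+ q; d ^+ r * c ^+ q; d ^+ r * d ^+ q]].

Definition formV (q : nat) (a b c d : k) := mx4
  [:: [:: a ^+ (2 * q); a ^+ q * b ^+ q; 0; b ^+ (2 * q)];
      [:: 0; 1; 0; 0];
      [:: a ^+ q * c ^+ q; b ^+ q * c ^+ q; 1; b ^+ q * d ^+ q];
      [:: c ^+ (2 * q); c ^+ q * d ^+ q; 0; d ^+ (2 * q)]].

Definition formVII (p q : nat) (a b c d : k) := mx4
  [:: [:: a ^+ (p * q); 0; 0; b ^+ (p * q)];
      [:: 2^-1 * a ^+ (2 * q) * c ^+ q; a ^+ q;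
          b ^+ q; 2^-1 * b ^+ (2 * q) * d ^+ q];
      [:: a ^+ q * c ^+ (2 * q); c ^+ q; d ^+ q; b ^+ q * d ^+ (2 * q)];
      [:: c ^+ (p * q); 0; 0; d ^+ (p * q)]].

Definition formIX (q : nat) (a b c d : k) := mx4
  [:: [:: a ^+ (2 * q); a ^+ q * b ^+ q; 0; 2^-1 * b ^+ (2 * q)];
      [:: 2 * a ^+ q * c ^+ q; a ^+ q * d ^+ q + b ^+ q * c ^+ q; 0;
          b ^+ q * d ^+ q];
      [:: 0; 0; 1; 0];
      [:: 2 * c ^+ (2 * q); 2 * c ^+ q * d ^+ q; 0; d ^+ (2 * q)]].

Definition formXI (q : nat) (a b c d : k) := mx4
  [:: [:: a ^+ (2 * q); a ^+ q * b ^+ q; 0; b ^+ (2 * q)];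
      [:: 0; 1; 0; 0];
      [:: 0; 0; 1; 0];
      [:: c ^+ (2 * q); c ^+ q * d ^+ q; 0; d ^+ (2 * q)]].

Definition formXV (r s : nat) (a b c d : k) := mx4
  [:: [:: a ^+ r; 0; 0; b ^+ r];
      [:: 0; a ^+ s; b ^+ s; 0];
      [:: 0; c ^+ s; d ^+ s; 0];
      [:: c ^+ r; 0; 0; d ^+ r]].

Definition formXIX (q : nat) (a b c d : k) := mx4
  [:: [:: a ^+ (2 * q); 0; 0; b ^+ (2 * q)];
      [:: 0; 1; 0; 0];
      [:: a ^+ q * c ^+ q; 0; 1; b ^+ q * d ^+ q];
      [:: c ^+ (2 * q); 0; 0; d ^+ (2 * q)]].

Definition formXXIV (r : nat) (a b c d : k) := mx4
  [:: [:: a ^+ r; 0; 0; b ^+ r];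
      [:: 0; 1; 0; 0];
      [:: 0; 0; 1; 0];
      [:: c ^+ r; 0; 0; d ^+ r]].

Definition formXXVI (a b c d : k) : 'M[k]_4 := 1%:M.

Inductive has_star_form (p : nat) (s : SL 2 k -> SL 4 k) : Prop :=
| StarI (e1 : nat) of (5 <= p)%N & given_by s (formI (p ^ e1))
| StarII (e1 : nat) of p = 3%N & given_by s (formII p (p ^ e1))
| StarIV (e1 e2 : nat) of (e1 < e2)%N & given_by s (formIV (p ^ e1) (p ^ e2))
| StarV (e1 : nat) of p = 2%N & given_by s (formV (p ^ e1))
| StarVII (e1 : nat) of p = 3%N & given_by s (formVII p (p ^ e1))
| StarIX (e1 : nat) of (3 <= p)%N & given_by s (formIX (p ^ e1))
| StarXI (e1 : nat) of p = 2%N & given_by s (formXI (p ^ e1))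
| StarXV (e2 e3 : nat) of (e3 <= e2)%N & given_by s (formXV (p ^ e2) (p ^ e3))
| StarXIX (e1 : nat) of p = 2%N & given_by s (formXIX (p ^ e1))
| StarXXIV (e2 : nat) of given_by s (formXXIV (p ^ e2))
| StarXXVI of given_by s formXXVI.

End Forms.

(* Main.v *)
(** In a basis of weight vectors for the diagonal torus the weights are
    [al >= be >= - be >= - al], the image of the unipotent [x |-> (1, x; 0, 1)]
    has entries [u i j * x ^ ((w i - w j) / 2)], and the Weyl element exchanges
    opposite weights.  Additivity in [x] of the (1, 4) entry forces the binomial
    coefficients ['C(al, n)], [0 < n < al], to vanish mod [p] unless [n] is
    [(al - be) / 2] or [(al + be) / 2]; hence [al] is [p^e], [2 p^e], [3 p^e] or
    [p^e + p^f].  The relation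
    [(1, 1; 0, 1) (0, -1; 1, 0) (1, 1; 0, 1) = (1, 0; 1, 1)], whose image is
    lower unitriangular, determines the Weyl element from the [u i j] and leaves
    one possibility per form up to a change of weight basis.  The forms are then
    recovered on the big cell from the Bruhat decomposition
    [(a, b; c, d) = (1, a/c; 0, 1) (0, -1; 1, 0) (c, 0; 0, 1/c) (1, d/c; 0, 1)]. *)

Require Import Defs.
From HB Require Import structures.
From mathcomp Require Import all_boot all_order all_fingroup all_algebra.
From mathcomp Require Import mpoly.
From mathcomp Require Import ring zify.

Set Implicit Arguments.
Unset Strict Implicit.
Unset Printing Implicit Defensive.

Import GRing.Theory.
Local Open Scope ring_scope.

(** * Polynomial functions and weights of a torus *)

Section PolynomialFunctions.
Variable k : closedFieldType.
Implicit Types (p q : {poly k}) (f g : k -> k).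

(** A conjugation commuting with the torus keeps the weight normal form, so representations with the
    same weights are compared through the six coefficients [u i j] alone. Diagonal matrices rescale
    them; when weights coincide the commuting matrices are larger, hence the separate cases [be = 0]
    and [be = al]. The Weyl relation already enters before the binomial argument: if [be < al] it
    forces [u14] to be nonzero, and without this, additivity would say nothing about the binomial
    coefficients. The delicate case is [al] a power of [p]: all its inner binomial coefficients
    vanish, and additivity kills only products such as [u12 * u24], or their sum, but not the
    factors. The representations that are not semisimple arise here; they survive only for [p = 2]
    with [be = 0] and for [p = 3] with [al = 3 * be]. *)

Lemma poly_fun_inj p q : (forall x : k, x != 0 -> p.[x] = q.[x]) -> p = q.
Proof.
move=> eq_pq; apply/eqP; rewrite -subr_eq0; apply/negPn/negP => nz_pq.
(* The factor ['X] makes the non-root supplied by the closed field different from 0. *)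
have /closed_nonrootP[x] : ('X * (p - q)) != 0 by rewrite mulf_neq0 ?polyX_eq0.
rewrite rootM negb_or rootX => /andP[nz_x] /negP[].
by rewrite /root hornerD hornerN eq_pq // subrr.
Qed.

(** One induction over [P] serves polynomial and Laurent functions alike. Closure of [C] under [=1]
    stands in for functional extensionality. *)
Lemma meval_fun_closed n (C : (k -> k) -> Prop) (v : 'I_n -> k -> k)
    (P : {mpoly k[n]}) :
  (forall c, C (fun=> c)) ->
  (forall f g, C f -> C g -> C (fun x => f x + g x)) ->
  (forall f g, C f -> C g -> C (fun x => f x * g x)) ->
  (forall f g, f =1 g -> C f -> C g) ->
  (forall i, C (v i)) -> C (fun x => P.@[v ^~ x]).
Proof.
move=> Cc CD CM Ce Cv; elim/mpolyind: P => [|c m P _ _ CP].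
  by apply: (Ce _ _ _ (Cc 0)) => x; rewrite meval0.
have Cm : C (fun x => 'X_[m].@[v ^~ x]).
  apply: (Ce (fun x => \prod_(i < n) v i x ^+ m i)) => [x|].
    by rewrite mevalX.
  elim: (index_enum _) => [|i r Cr]; first by apply: (Ce _ _ _ (Cc 1)) => x;
    rewrite big_nil.
  apply: (Ce _ _ _ (CM (fun x => v i x ^+ m i) _ _ Cr)) => [x|]; first by rewrite big_cons.
  elim: (m i : nat) => [|j Cj]; first exact: (Ce _ _ _ (Cc 1)).
  by apply: (Ce _ _ _ (CM _ _ (Cv i) Cj)) => x; rewrite exprS.
by apply: (Ce _ _ _ (CD _ _ (CM _ _ (Cc c) Cm) CP)) => x; rewrite mevalD mevalZ.
Qed.

Definition polynomial_fun f := exists p, forall x, f x = p.[x].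

(** Nothing is asked at 0, where [torus] only has the default value of [insubd]. *)
Definition laurent_fun f :=
  exists N p, forall x : k, x != 0 -> x ^+ N * f x = p.[x].

Lemma meval_polynomial n (v : 'I_n -> k -> k) (P : {mpoly k[n]}) :
  (forall i, polynomial_fun (v i)) -> polynomial_fun (fun x => P.@[v ^~ x]).
Proof.
apply: meval_fun_closed => [c|f g [p fE] [q gE]|f g [p fE] [q gE]|f g eq_fg [p fE]].
- by exists c%:P => x; rewrite hornerC.
- by exists (p + q) => x; rewrite hornerD fE gE.
- by exists (p * q) => x; rewrite hornerM fE gE.
- by exists p => x; rewrite -eq_fg fE.
Qed.

Lemma meval_laurent n (v : 'I_n -> k -> k) (P : {mpoly k[n]}) :
  (forall i, laurent_fun (v i)) -> laurent_fun (fun x => P.@[v ^~ x]).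
Proof.
apply: meval_fun_closed => [c|f g [M [p fE]] [N [q gE]]|f g [M [p fE]] [N [q gE]]|].
- by exists 0%N, c%:P => x _; rewrite hornerC mul1r.
- exists (M + N)%N, ('X^N * p + 'X^M * q) => x nz_x.
  by rewrite hornerD !hornerM !hornerXn -fE // -gE // exprD; ring.
- exists (M + N)%N, (p * q) => x nz_x.
  by rewrite hornerM -fE // -gE // exprD; ring.
by move=> f g eq_fg [N [p fE]]; exists N, p => x nz_x; rewrite -eq_fg fE.
Qed.

End PolynomialFunctions.

Section TorusWeights.
Variable k : closedFieldType.

Lemma matrix_poly_coef0 n N (H : 'I_N -> 'M[k]_n) :
  (forall s : k, s != 0 -> \sum_(i < N) s ^+ i *: H i = 0) -> forall i, H i = 0.
Proof.
move=> H0 i; apply/matrixP => a b; rewrite mxE.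
pose p := \poly_(j < N) (if insub j is Some j' then H j' a b else 0).
have p0 : p = 0.
  apply: poly_fun_inj => s /H0/matrixP/(_ a b); rewrite horner0 mxE summxE => <-.
  rewrite horner_poly; apply: eq_bigr => j _.
  by rewrite valK mxE mulrC.
by have := congr1 (fun q : {poly k} => q`_i) p0; rewrite coef_poly ltn_ord valK coef0.
Qed.

(** [H] is annihilated by the split polynomial with simple roots 0 and 1. *)
Lemma idempotent_diagonalizable n (H : 'M[k]_n) :
  H *m H = H -> exists2 P, P \in unitmx & is_diag_mx (conjmx P H).
Proof.
case: n => [|n] in H *.
  by exists 1%:M; rewrite ?unitmx1 //; apply/is_diag_mxP => -[].
move=> HH; apply/diagonalizableP; exists [:: 0; 1].
  by rewrite /= inE eq_sym oner_eq0.
rewrite big_cons big_seq1; apply: mxminpoly_min.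
rewrite rmorphM !rmorphB /= !horner_mx_X !horner_mx_C raddf0 subr0.
by rewrite mulrBr mulr1 -[H * H]/(H *m H) HH subrr.
Qed.

(** Write [h s] as a Laurent polynomial in [s] with matrix coefficients. Multiplicativity makes the
    coefficients orthogonal idempotents, and [h 1 = 1] makes their sum the identity. After
    simultaneous diagonalisation each basis vector belongs to exactly one of them, whose exponent is
    its weight. *)
Lemma torus_weights n (h : k -> 'M[k]_n) :
  (forall i j, laurent_fun (fun s => h s i j)) ->
  (forall s t : k, s != 0 -> t != 0 -> h (s * t) = h s *m h t) ->
  h 1 = 1%:M ->
  exists2 P : 'M[k]_n, P \in unitmx & exists w : 'I_n -> int,
    forall s : k, s != 0 -> P *m h s *m invmx P = diag_mx (\row_i s ^ w i).
Proof.
move=> hL hM h1.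
have [M [H hE]] : exists M, exists H : 'I_M -> 'M[k]_n,
    exists N, forall s : k, s != 0 -> s ^+ N *: h s = \sum_(i < M) s ^+ i *: H i.
  have /fin_all_exists[N /fin_all_exists[p Np]] : forall ij : 'I_n * 'I_n,
      exists N, exists p : {poly k}, forall s : k, s != 0 -> s ^+ N * h s ij.1 ij.2 = p.[s].
    by case=> i j; have [N [p hE]] := hL i j; exists N, p.
  (* All entries receive the same power of [s] as denominator, and [M] bounds the sizes of all
     numerators. *)
  pose N0 := \max_ij N ij.
  pose p' ij := 'X^(N0 - N ij) * p ij.
  pose M := \max_ij size (p' ij).
  exists M, (fun l => \matrix_(i, j) (p' (i, j))`_l), N0 => s nz_s.
  apply/matrixP => i j; rewrite mxE summxE.
  have -> : s ^+ N0 * h s i j = (p' (i, j)).[s].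
    rewrite hornerM hornerXn -Np // mulrA -exprD subnK //.
    exact: (leq_bigmax (i, j)).
  rewrite (horner_coef_wide (n := M)); last exact: (leq_bigmax (i, j)).
  by apply: eq_bigr => l _; rewrite !mxE mulrC.
case: hE => N hE.
(* Multiplicativity says that a matrix polynomial in two variables vanishes at all nonzero [s] and
   [t]; [matrix_poly_coef0] is applied once for each variable. *)
have HH (i j : 'I_M) : H i *m H j = if i == j then H i else 0.
  apply/eqP; rewrite -subr_eq0; apply/eqP; move: j.
  apply: matrix_poly_coef0 => t nz_t; move: i.
  apply: matrix_poly_coef0 => s nz_s.
  under eq_bigr do rewrite scaler_sumr.
  have -> : \sum_(i < M) \sum_(j < M) s ^+ i *: (t ^+ j *: (H i *m H j - (if i == j then
    H i else 0)))
    = (\sum_(i < M) s ^+ i *: H i) *m (\sum_(j < M) t ^+ j *: H j) - \sum_(i < M) (s * t)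
      ^+ i *: H i.
    rewrite mulmx_suml -sumrB; apply: eq_bigr => i _.
    rewrite mulmx_sumr (bigD1 i) //= eqxx [in RHS](bigD1 i) //= addrAC.
    rewrite -!scalemxAl -!scalemxAr !scalerBr !scalerA -exprMn; congr (_ + _).
    apply: eq_bigr => j /negPf ne_ji.
    by rewrite eq_sym ne_ji subr0 -scalemxAl -scalemxAr.
  rewrite -!hE ?mulf_neq0 // -scalemxAl -scalemxAr scalerA -exprMn -hM //.
  by rewrite subrr.
have sumH : \sum_i H i = 1%:M.
  have := hE 1 (oner_neq0 _); rewrite expr1n scale1r h1 => ->.
  by apply: eq_bigr => i _; rewrite expr1n scale1r.
have [P uP PH] : exists2 P : 'M[k]_n, P \in unitmx &
    forall i, is_diag_mx (conjmx P (H i)).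
  have [P uP /allP PH] : codiagonalizable (codom H).
    apply/codiagonalizableP; split.
      move=> _ _ /codomP[i ->] /codomP[j ->]; rewrite /comm_mx !HH eq_sym.
      by case: eqVneq => // ->.
    by move=> _ /codomP[i ->]; apply: idempotent_diagonalizable; rewrite HH eqxx.
  by exists P => // i; apply: (PH (H i)); rewrite codom_f.
pose D i := P *m H i *m invmx P.
have DD i j : D i *m D j = if i == j then D i else 0.
  rewrite /D !mulmxA mulmxKV // -[P *m H i *m H j]mulmxA HH.
  by case: eqP; rewrite ?mulmx0 ?mul0mx.
have Ddiag i l l' : l != l' -> D i l l' = 0.
  by move=> ne; have:= PH i; rewrite conjumx // => /is_diag_mxP; apply.
have sumD l : \sum_i D i l l = 1.
  rewrite -summxE -mulmx_suml -mulmx_sumr sumH mulmx1 mulmxV //.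
  by rewrite mxE eqxx.
have DDl i j l : D i l l * D j l l = if i == j then D i l l else 0.
  have /matrixP/(_ l l) := DD i j; rewrite mxE (bigD1 l) //= big1 => [|l' ne].
    by rewrite addr0; case: eqP => // _ ->; rewrite mxE.
  by rewrite Ddiag ?mul0r // eq_sym.
(* The entries [D i l l] sum to 1, so one of them is nonzero; orthogonality then excludes all the
   others. *)
have /fin_all_exists[e De] : forall l, exists i, D i l l != 0.
  move=> l; apply/existsP; rewrite -negb_forall; apply/negP => /forallP D0.
  have := sumD l; rewrite big1 => [|i _]; last exact/eqP.
  by move/eqP; rewrite eq_sym oner_eq0.
have De1 l i : D i l l = (i == e l)%:R.
  have D0 : i != e l -> D i l l = 0.
    move=> /negPf ne; have /eqP := DDl i (e l) l.
    by rewrite ne mulf_eq0 (negPf (De l)) orbF => /eqP.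
  have [->|/D0//] := eqVneq; apply: (mulfI (De l)).
  by rewrite DDl eqxx mulr1.
exists P => //; exists (fun l => (e l)%:Z - N%:Z) => s nz_s.
have -> : h s = s ^- N *: \sum_(i < M) s ^+ i *: H i.
  by rewrite -hE // scalerA mulVf ?scale1r ?expf_neq0.
rewrite -scalemxAr -scalemxAl mulmx_sumr mulmx_suml.
apply/matrixP => l l'; rewrite !mxE summxE.
rewrite (eq_bigr (fun i : 'I_M => s ^+ i * D i l l')) => [|i _]; last first.
  by rewrite -scalemxAr -scalemxAl mxE.
have [<-|ne] := eqVneq l l'; last first.
  by rewrite big1 ?mulr0 // => i _; rewrite Ddiag ?mulr0.
rewrite (bigD1 (e l)) //= De1 eqxx big1 => [|i /negPf ne]; last first.
  by rewrite De1 ne mulr0.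
by rewrite mulr1 addr0 mulr1n expfzDr // exprnN mulrC.
Qed.

End TorusWeights.

(** * Elements of SL(2, k) and weight normal form *)

Section Conjugation.
Variables (n : nat) (k : fieldType).

Fact sl_conj_subproof (P : 'M[k]_n) (uP : P \in unitmx) (A : SL n k) :
  \det (invmx P *m slval A *m P) == 1.
Proof.
by rewrite !det_mulmx (eqP (slvalP A)) mulr1 -det_mulmx mulVmx // det1.
Qed.

Definition sl_conj P uP A := MkSL (@sl_conj_subproof P uP A).

Lemma sl_conj_hom m P uP (s : SL m k -> SL n k) :
  algebraic_group_hom s -> algebraic_group_hom (@sl_conj P uP \o s).
Proof.
case=> sM [Q sE]; split=> [A B|].
  by apply: val_inj; rewrite /= sM /= !mulmxA mulmxK.
exists (map_mx (@mpolyC _ _) (invmx P) *m Q *m map_mx (@mpolyC _ _) P) => A i j.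
rewrite /= !mxE rmorph_sum /=; apply: eq_bigr => l _.
rewrite !mxE mevalM mevalC rmorph_sum /=; congr (_ * _).
by apply: eq_bigr => l' _; rewrite mevalM !mxE mevalC sE.
Qed.

End Conjugation.

Section SL2Elements.
Variable k : fieldType.
Implicit Types a b c d x y : k.

Definition mx2 a b c d : 'M[k]_2 :=
  \matrix_(i, j) nth 0 (nth [::] [:: [:: a; b]; [:: c; d]] i) j.

(* Meaningful only when [a * d - b * c = 1]. *)
Definition sl2 a b c d : SL 2 k := insubd (1%g : SL 2 k) (mx2 a b c d).

Lemma det_mx22 (A : 'M[k]_2) : \det A = A 0 0 * A 1 1 - A 0 1 * A 1 0.
Proof.
rewrite (expand_det_row _ 0) !big_ord_recl big_ord0 /cofactor !det_mx11 !mxE /=.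
rewrite expr0 expr1 mul1r addr0 mulN1r mulrN.
by congr (A _ _ * A _ _ - A _ _ * A _ _); apply: val_inj.
Qed.

Lemma sl2E a b c d : a * d - b * c = 1 -> slval (sl2 a b c d) = mx2 a b c d.
Proof. by move=> dt; rewrite insubdK // -topredE /= det_mx22 !mxE /= dt. Qed.

Lemma sl2_eta (A : SL 2 k) : A = sl2 (A 0 0) (A 0 1) (A 1 0) (A 1 1).
Proof.
have dA : A 0 0 * A 1 1 - A 0 1 * A 1 0 = 1 by rewrite -(eqP (slvalP A)) det_mx22.
apply: val_inj; rewrite /= sl2E //; apply/matrixP => i j; rewrite mxE.
by case: i j => [[|[|//]] ?] [[|[|//]] ?] /=; congr (slval A _ _); apply: val_inj.
Qed.

Lemma sl2M a b c d a' b' c' d' :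
  a * d - b * c = 1 -> a' * d' - b' * c' = 1 ->
  (sl2 a b c d * sl2 a' b' c' d')%g =
  sl2 (a * a' + b * c') (a * b' + b * d') (c * a' + d * c') (c * b' + d * d').
Proof.
move=> dt dt'; apply: val_inj; rewrite /= !sl2E //; last first.
  by rewrite -[RHS]mul1r -{1}dt -dt'; ring.
apply/matrixP => i j; rewrite !mxE !big_ord_recl big_ord0 !mxE.
by case: i j => [[|[|//]] ?] [[|[|//]] ?] /=; rewrite addr0.
Qed.

Lemma sl2_1 : sl2 1 0 0 1 = 1%g.
Proof.
apply: val_inj; rewrite /= sl2E ?mulr1 ?mulr0 ?subr0 //.
by apply/matrixP => i j; rewrite !mxE; case: i j => [[|[|//]] ?] [[|[|//]] ?].
Qed.

End SL2Elements.

Section Weights.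
Variable k : closedFieldType.

Definition torus (s : k) := sl2 s 0 0 s^-1.
Definition upper (x : k) := sl2 1 x 0 1.
Definition lower (x : k) := sl2 1 0 x 1.
Definition weyl : SL 2 k := sl2 0 (- 1) 1 0.

Ltac sl2_tac := rewrite /torus /upper /lower /weyl ?sl2M; [congr sl2|..];
  try by field.

Lemma torusM (s t : k) : s != 0 -> t != 0 -> torus (s * t) = (torus s * torus t)%g.
Proof. by move=> nz_s nz_t; sl2_tac; field; rewrite nz_s nz_t. Qed.

Lemma upperD (x y : k) : upper (x + y) = (upper x * upper y)%g.
Proof. by sl2_tac. Qed.

Lemma torus_upper (s x : k) : s != 0 ->
  (torus s * upper x)%g = (upper (s ^+ 2 * x) * torus s)%g.
Proof. by move=> nz_s; sl2_tac. Qed.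

(** Stated with [s^-1] so that [x] is scaled by [s ^+ 2] as in [torus_upper]; one equivariance lemma
    then covers both subgroups, with weights negated for [lower]. *)
Lemma torus_lower (s x : k) : s != 0 ->
  (torus s^-1 * lower x)%g = (lower (s ^+ 2 * x) * torus s^-1)%g.
Proof. by move=> nz_s; rewrite /torus invrK; sl2_tac. Qed.

Lemma weyl_torus (s : k) : s != 0 -> (weyl * torus s)%g = (torus s^-1 * weyl)%g.
Proof. by move=> nz_s; rewrite /torus invrK; sl2_tac. Qed.

Lemma lower_bruhat : lower 1 = (upper 1 * weyl * upper 1)%g.
Proof. by sl2_tac. Qed.

Lemma big_cell (a b c d : k) : a * d - b * c = 1 -> c != 0 ->
  sl2 a b c d = (upper (a / c) * weyl * torus c * upper (d / c))%g.
Proof.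
move=> dt nz_c; have -> : b = (a * d - 1) / c by rewrite -dt; field.
by sl2_tac.
Qed.

(** Covers the complement of the big cell. *)
Lemma borel (a b d : k) : a * d = 1 -> sl2 a b 0 d = (upper (a * b) * torus a)%g.
Proof.
move=> dt; have nz_a : a != 0 by apply: contra_eq_neq dt => ->;
  rewrite mul0r eq_sym oner_neq0.
have -> : d = a^-1 by apply: (mulfI nz_a); rewrite dt divff.
by sl2_tac.
Qed.

End Weights.

Section WeightNormalForm.
Variable k : closedFieldType.

Lemma exprz_inj_fun (m n : int) : (forall s : k, s != 0 -> s ^ m = s ^ n) -> m = n.
Proof.
wlog le_nm : m n / (n <= m)%R => [IH eq_mn|eq_mn].
  have [/IH->//|lt_mn] := boolP (n <= m)%R; symmetry; apply: IH => [|s /eq_mn //].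
  by lia.
have Xd : 'X^(`|m - n|%N) = 1 :> {poly k}.
  apply: poly_fun_inj => s nz_s; rewrite hornerXn hornerE.
  rewrite exprnP gez0_abs; last by lia.
  by rewrite expfzDr // eq_mn // -expfzDr // subrr.
have := congr1 (fun q : {poly k} => size q) Xd.
by rewrite size_polyXn size_poly1 => -[]; lia.
Qed.

Lemma regular_laurent n (s : SL 2 k -> SL n k) i j :
  regular_map s -> laurent_fun (fun c => s (torus c) i j).
Proof.
case=> P sE; have [i'|N [p pE]] := @meval_laurent k _ (fun i' c =>
  mxvec (torus c) 0 i') (P i j).
  case/mxvec_indexP: i' => a b.
  have tE c : c != 0 -> mxvec (torus c) 0 (mxvec_index a b) = mx2 c 0 0 c^-1 a b.
    by move=> nz_c; rewrite mxvecE /torus sl2E // mulfV // mulr0 subr0.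
  case: a b tE => [[|[|//]] ?] [[|[|//]] ?] tE.
  - by exists 0%N, 'X => c nz_c; rewrite tE // mxE hornerX mul1r.
  - by exists 0%N, 0 => c nz_c; rewrite tE // mxE horner0 mulr0.
  - by exists 0%N, 0 => c nz_c; rewrite tE // mxE horner0 mulr0.
  - by exists 1%N, 1 => c nz_c; rewrite tE // mxE hornerE /= expr1 mulfV.
by exists N, p => c nz_c; rewrite -pE // sE.
Qed.

Lemma equivalent_trans n (s1 s2 s3 : SL 2 k -> SL n k) :
  equivalent s1 s2 -> equivalent s2 s3 -> equivalent s1 s3.
Proof.
case=> [P uP sP] [Q uQ sQ]; exists (P *m Q); first by rewrite unitmx_mul uP.
move=> A; rewrite -sQ -sP; rewrite !mulmxA; congr (_ *m _ *m _ *m _).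
apply: (row_free_inj (A := P *m Q)); first by rewrite row_free_unit unitmx_mul uP.
by rewrite mulVmx ?unitmx_mul ?uP // !mulmxA mulmxKV // mulVmx.
Qed.

Lemma sl_conj_equivalent n P uP (s : SL 2 k -> SL n k) :
  equivalent s (@sl_conj n k P uP \o s).
Proof. by exists P. Qed.

Lemma hom1 n (s : SL 2 k -> SL n k) : {morph s : A B / (A * B)%g} -> s 1%g = 1%g.
Proof. by move=> sM; apply: (mulgI (s 1%g)); rewrite -sM !mulg1. Qed.

(** In the [(i, j)] entry of [weyl_torus] a nonzero coefficient cancels, leaving an equality of two
    characters of the torus. *)
Lemma weyl_weights n (s : SL 2 k -> SL n k) (w : 'I_n -> int) :
  {morph s : A B / (A * B)%g} ->
  (forall c, c != 0 -> slval (s (torus c)) = diag_mx (\row_i c ^ w i)) ->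
  forall i j, s (weyl k) i j != 0 -> w j = - w i.
Proof.
move=> sM sT i j nz_ij; apply: exprz_inj_fun => c nz_c.
have := congr1 (fun A => slval (s A) i j) (weyl_torus nz_c).
rewrite !sM /= !sT ?invr_eq0 // mul_mx_diag mul_diag_mx !mxE mulrC.
by move/(mulIf nz_ij) => ->; rewrite exprz_inv.
Qed.

Definition wt (al be : nat) (i : 'I_4) : int :=
  nth 0 [:: al%:Z; be%:Z; - be%:Z; - al%:Z] i.

(** The Weyl image is invertible, so some term of the Leibniz formula is nonzero, and its
    permutation matches every weight with its negative. The sorted list of the four weights is
    therefore its own reversed negation. *)
Lemma weight_normal_form (s : SL 2 k -> SL 4 k) : algebraic_group_hom s ->
  exists s', [/\ algebraic_group_hom s', equivalent s s' &
    exists al be : nat, (be <= al)%N /\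
      forall c, c != 0 -> slval (s' (torus c)) = diag_mx (\row_i c ^ wt al be i)].
Proof.
move=> hs; have [sM sR] := hs.
have [i j|c d nz_c nz_d||P uP [w0 hw0]] := @torus_weights k 4 (fun c =>
  slval (s (torus c))).
- exact: regular_laurent.
- by rewrite torusM // sM.
- by rewrite /torus invr1 sl2_1 hom1.
have uP' : invmx P \in unitmx by rewrite unitmx_inv.
pose s1 := sl_conj uP' \o s.
have hs1 : algebraic_group_hom s1 by exact: sl_conj_hom.
have sT1 c : c != 0 -> slval (s1 (torus c)) = diag_mx (\row_i c ^ w0 i).
  by move=> nz_c; rewrite /= invmxK hw0.
have [pi w0pi] : exists pi : 'S_4, forall i, w0 (pi i) = - w0 i.
  have: \det (slval (s1 (weyl k))) != 0 by rewrite (eqP (slvalP _)) oner_eq0.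
  move=> nz_det; have /existsP[pi nz_pi] : [exists pi : 'S_4,
    \prod_i s1 (weyl k) i (pi i) != 0].
    apply: contraR nz_det; rewrite negb_exists => /forallP z.
    rewrite /determinant big1 // => pi _; have := z pi; rewrite negbK => /eqP ->.
    by rewrite mulr0.
  exists pi => i; apply: (weyl_weights hs1.1 sT1).
  by move/prodf_neq0: nz_pi; apply.
pose ge := fun x y : int => (y <= x)%R.
have ge_sym : antisymmetric ge by move=> x y; rewrite /ge; lia.
have ge_tr : transitive ge by move=> y x z; rewrite /ge; lia.
have ge_tot : total ge by move=> x y; rewrite /ge; lia.
pose tw : 4.-tuple int := [tuple w0 i | i < 4].
have /tuple_permP[rho rhoE] : perm_eq (sort ge tw) tw by rewrite perm_sort.
set T := sort ge tw in rhoE.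
have sT : sorted ge T by apply: sort_sorted.
(* Both lists are sorted in decreasing order, and [pi] shows that they are permutations of each
   other. *)
have TN : T = rev (map -%R T).
  apply: (sorted_eq ge_tr ge_sym) => //.
    rewrite rev_sorted sorted_map; apply: sub_sorted sT => x y; rewrite /ge /=; lia.
  have TE : perm_eq T tw by rewrite perm_sort.
  rewrite perm_sym perm_rev; apply: (perm_trans (perm_map _ TE)).
  rewrite perm_sym (permPl TE) perm_sym.
  apply/tuple_permP; exists pi; rewrite -map_comp.
  by apply: eq_map => i /=; rewrite tnth_mktuple w0pi.
have uR : perm_mx rho^-1%g \in (@unitmx k 4) by exact: unitmx_perm.
exists (sl_conj uR \o s1); split.
- exact: sl_conj_hom.
- exact: equivalent_trans (sl_conj_equivalent uP' s) (sl_conj_equivalent uR s1).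
have sT2 c : c != 0 -> slval (sl_conj uR (s1 (torus c))) = diag_mx (\row_i c ^ w0 (rho i)).
  move=> nz_c; rewrite /sl_conj; cbn [slval].
  rewrite sT1 //; have -> : invmx (perm_mx rho^-1) = perm_mx rho :> 'M[k]_4.
    by rewrite -[LHS]mul1mx -(perm_mx1 _ 4) -(mulgV rho) perm_mxM mulmxK.
  rewrite -row_permE -col_permE; apply/matrixP => i j.
  by rewrite !mxE (inj_eq perm_inj).
have Tnth (i : 'I_4) : nth 0 T i = w0 (rho i).
  by rewrite rhoE -tnth_nth !tnth_mktuple.
have sizeT : size T = 4 by rewrite rhoE size_tuple.
clearbody T; case: T sizeT sT TN Tnth {rhoE} => [|x0 [|x1 [|x2 [|x3 [|//]]]]] //= _.
rewrite /ge => /and4P[le10 le21 le32 _] [x03 x12 _ _] Tnth.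
exists `|x0|%N, `|x1|%N; split; first by lia.
move=> c nz_c; apply: etrans (sT2 c nz_c) _; congr diag_mx; apply/rowP => i;
  rewrite !mxE -Tnth.
by congr (c ^ _); case: i => [[|[|[|[|//]]]] ?] /=; rewrite /wt /=; lia.
Qed.

End WeightNormalForm.

(** * Explicit 4 by 4 matrices *)

Section ExplicitMatrices.
Variable k : fieldType.

Lemma mx4_eta (A : 'M[k]_4) (i0 := @Ordinal 4 0 isT) (i1 := @Ordinal 4 1 isT)
    (i2 := @Ordinal 4 2 isT) (i3 := @Ordinal 4 3 isT) :
  A = mx4 [:: [:: A i0 i0; A i0 i1; A i0 i2; A i0 i3];
              [:: A i1 i0; A i1 i1; A i1 i2; A i1 i3];
              [:: A i2 i0; A i2 i1; A i2 i2; A i2 i3];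
              [:: A i3 i0; A i3 i1; A i3 i2; A i3 i3]].
Proof.
apply/matrixP => i j; rewrite mxE.
by case: i j => [[|[|[|[|//]]]] ?] [[|[|[|[|//]]]] ?] /=; congr (A _ _); apply: val_inj.
Qed.

Lemma mx4M a11 a12 a13 a14 a21 a22 a23 a24 a31 a32 a33 a34 a41 a42 a43 a44
    b11 b12 b13 b14 b21 b22 b23 b24 b31 b32 b33 b34 b41 b42 b43 b44 :
  mx4 [:: [:: a11; a12; a13; a14]; [:: a21; a22; a23; a24];
          [:: a31; a32; a33; a34]; [:: a41; a42; a43; a44]] *m
  mx4 [:: [:: b11; b12; b13; b14]; [:: b21; b22; b23; b24];
          [:: b31; b32; b33; b34]; [:: b41; b42; b43; b44]] =
  mx4 [::
    [:: a11 * b11 + a12 * b21 + a13 * b31 + a14 * b41;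
        a11 * b12 + a12 * b22 + a13 * b32 + a14 * b42;
        a11 * b13 + a12 * b23 + a13 * b33 + a14 * b43;
        a11 * b14 + a12 * b24 + a13 * b34 + a14 * b44];
    [:: a21 * b11 + a22 * b21 + a23 * b31 + a24 * b41;
        a21 * b12 + a22 * b22 + a23 * b32 + a24 * b42;
        a21 * b13 + a22 * b23 + a23 * b33 + a24 * b43;
        a21 * b14 + a22 * b24 + a23 * b34 + a24 * b44];
    [:: a31 * b11 + a32 * b21 + a33 * b31 + a34 * b41;
        a31 * b12 + a32 * b22 + a33 * b32 + a34 * b42;
        a31 * b13 + a32 * b23 + a33 * b33 + a34 * b43;
        a31 * b14 + a32 * b24 + a33 * b34 + a34 * b44];
    [:: a41 * b11 + a42 * b21 + a43 * b31 + a44 * b41;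
        a41 * b12 + a42 * b22 + a43 * b32 + a44 * b42;
        a41 * b13 + a42 * b23 + a43 * b33 + a44 * b43;
        a41 * b14 + a42 * b24 + a43 * b34 + a44 * b44]] :> 'M[k]_4.
Proof.
apply/matrixP => i j; rewrite !mxE !big_ord_recr big_ord0 /= add0r !mxE.
by case: i j => [[|[|[|[|//]]]] ?] [[|[|[|[|//]]]] ?].
Qed.

Lemma mx4_inj a11 a12 a13 a14 a21 a22 a23 a24 a31 a32 a33 a34 a41 a42 a43 a44
    b11 b12 b13 b14 b21 b22 b23 b24 b31 b32 b33 b34 b41 b42 b43 b44 :
  mx4 [:: [:: a11; a12; a13; a14]; [:: a21; a22; a23; a24];
          [:: a31; a32; a33; a34]; [:: a41; a42; a43; a44]] =
  mx4 [:: [:: b11; b12; b13; b14]; [:: b21; b22; b23; b24];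
          [:: b31; b32; b33; b34]; [:: b41; b42; b43; b44]] :> 'M[k]_4 ->
  [/\ [/\ a11 = b11, a12 = b12, a13 = b13 & a14 = b14],
      [/\ a21 = b21, a22 = b22, a23 = b23 & a24 = b24],
      [/\ a31 = b31, a32 = b32, a33 = b33 & a34 = b34] &
      [/\ a41 = b41, a42 = b42, a43 = b43 & a44 = b44]].
Proof.
move/matrixP => E.
have F (i j : nat) (lt_i : (i < 4)%N) (lt_j : (j < 4)%N) := E (Ordinal lt_i) (Ordinal lt_j).
split; split.
- by have := F 0%N 0%N isT isT; rewrite !mxE.
- by have := F 0%N 1%N isT isT; rewrite !mxE.
- by have := F 0%N 2%N isT isT; rewrite !mxE.
- by have := F 0%N 3%N isT isT; rewrite !mxE.
- by have := F 1%N 0%N isT isT; rewrite !mxE.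
- by have := F 1%N 1%N isT isT; rewrite !mxE.
- by have := F 1%N 2%N isT isT; rewrite !mxE.
- by have := F 1%N 3%N isT isT; rewrite !mxE.
- by have := F 2%N 0%N isT isT; rewrite !mxE.
- by have := F 2%N 1%N isT isT; rewrite !mxE.
- by have := F 2%N 2%N isT isT; rewrite !mxE.
- by have := F 2%N 3%N isT isT; rewrite !mxE.
- by have := F 3%N 0%N isT isT; rewrite !mxE.
- by have := F 3%N 1%N isT isT; rewrite !mxE.
- by have := F 3%N 2%N isT isT; rewrite !mxE.
- by have := F 3%N 3%N isT isT; rewrite !mxE.
Qed.

Lemma mx4_1 : mx4 [:: [:: 1; 0; 0; 0]; [:: 0; 1; 0; 0]; [:: 0; 0; 1; 0]; [:: 0; 0; 0; 1]]
  = 1%:M :> 'M[k]_4.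
Proof.
by apply/matrixP => i j; rewrite !mxE; case: i j => [[|[|[|[|//]]]] ?] [[|[|[|[|//]]]] ?].
Qed.

End ExplicitMatrices.

(** * Torus equivariance and the shape of the unipotent images *)

Section WeightRepresentations.
Variable k : closedFieldType.
Implicit Types (s : SL 2 k -> SL 4 k) (x c : k).

Definition torus_mx (al be : nat) c : 'M[k]_4 :=
  mx4 [:: [:: c ^+ al; 0; 0; 0]; [:: 0; c ^+ be; 0; 0];
          [:: 0; 0; c ^- be; 0]; [:: 0; 0; 0; c ^- al]].

(* The halvings truncate; [upper_data] below records that an entry whose weight
   difference is odd has coefficient 0. *)
Definition upper_mx (al be : nat) u12 u13 u14 u23 u24 u34 x : 'M[k]_4 :=
  mx4 [:: [:: 1; u12 * x ^+ (al - be)./2; u13 * x ^+ (al + be)./2; u14 * x ^+ al];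
          [:: 0; 1; u23 * x ^+ be; u24 * x ^+ (al + be)./2];
          [:: 0; 0; 1; u34 * x ^+ (al - be)./2];
          [:: 0; 0; 0; 1]].

Definition weight_rep al be s :=
  algebraic_group_hom s /\
  forall c, c != 0 -> slval (s (torus c)) = torus_mx al be c.

Lemma diag_wt al be c :
  diag_mx (\row_i c ^ wt al be i) = torus_mx al be c.
Proof.
apply/matrixP => i j; rewrite !mxE.
by case: i j => [[|[|[|[|//]]]] ?] [[|[|[|[|//]]]] ?] //=; rewrite mulr1n /wt /= exprnN.
Qed.

(** A nonzero coefficient in degree [i] forces [c ^ m = c ^ (n + 2 * i)] for all nonzero [c], so
    only degree [(m - n) / 2] can occur. The condition on [a] records that [m - n] is then even and
    nonnegative. *)
Lemma weight_monomial (f : k -> k) (m n : int) : polynomial_fun f ->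
    (forall c x, c != 0 -> c ^ m * f x = f (c ^+ 2 * x) * c ^ n) ->
  exists2 a, a != 0 -> m - n = (`|m - n|./2).*2%:Z & forall x, f x = a * x ^+ `|m - n|./2.
Proof.
case=> p fE fT.
have pT i : p`_i != 0 -> m - n = i.*2%:Z.
  move=> nz_pi; suff -> : m = n + i.*2%:Z by lia.
  apply: (@exprz_inj_fun k) => c nz_c; apply: (mulIf nz_pi).
  have : c ^ m *: p = c ^ n *: \poly_(j < size p) (c ^+ j.*2 * p`_j).
    apply: poly_fun_inj => x _.
    rewrite !hornerZ -fE fT // mulrC fE horner_poly [p.[_]]horner_coef; congr (_ * _).
    by apply: eq_bigr => j _; rewrite exprMn -exprM mul2n; ring.
  move/(congr1 (fun q : {poly k} => q`_i)); rewrite !coefZ => ->.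
  rewrite coef_poly ifT; last by apply: contraNT nz_pi;
    rewrite -leqNgt => /(nth_default 0) ->.
  by rewrite expfzDr // mulrA.
exists p`_(`|m - n|./2) => [/pT|x]; first by lia.
rewrite fE; suff -> : p = p`_(`|m - n|./2) *: 'X^(`|m - n|./2) by rewrite !(hornerE,
  hornerXn) coefZ coefXn eqxx mulr1.
apply/polyP => i; rewrite coefZ coefXn.
have [->|ne_i] := eqVneq i; first by rewrite mulr1.
rewrite mulr0; apply/eqP/negPn/negP => /pT; lia.
Qed.

Lemma regular_upper n (s : SL 2 k -> SL n k) i j :
  regular_map s -> polynomial_fun (fun x => s (upper x) i j) /\
    polynomial_fun (fun x => s (lower x) i j).
Proof.
case=> P sE.
split.
  have [i'|p pE] := @meval_polynomial k _ (fun i' c => mxvec (upper c) 0 i') (P i j).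
    case/mxvec_indexP: i' => a b.
    have tE c : mxvec (upper c) 0 (mxvec_index a b) = mx2 1 c 0 1 a b.
      by rewrite mxvecE /upper sl2E // mulr0 subr0 mulr1.
    case: a b tE => [[|[|//]] ?] [[|[|//]] ?] tE.
    - by exists 1 => c; rewrite tE mxE hornerE.
    - by exists 'X => c; rewrite tE mxE hornerX.
    - by exists 0 => c; rewrite tE mxE horner0.
    - by exists 1 => c; rewrite tE mxE hornerE.
  by exists p => c; rewrite -pE sE.
have [i'|p pE] := @meval_polynomial k _ (fun i' c => mxvec (lower c) 0 i') (P i j).
  case/mxvec_indexP: i' => a b.
  have tE c : mxvec (lower c) 0 (mxvec_index a b) = mx2 1 0 c 1 a b.
    by rewrite mxvecE /lower sl2E // mul0r subr0 mulr1.
  case: a b tE => [[|[|//]] ?] [[|[|//]] ?] tE.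
  - by exists 1 => c; rewrite tE mxE hornerE.
  - by exists 0 => c; rewrite tE mxE horner0.
  - by exists 'X => c; rewrite tE mxE hornerX.
  - by exists 1 => c; rewrite tE mxE hornerE.
by exists p => c; rewrite -pE sE.
Qed.

End WeightRepresentations.

Section WeightShapes.
Variable k : closedFieldType.
Implicit Types (s : SL 2 k -> SL 4 k) (x c : k).

(** The value at 0 fixes the entries between equal weights, which are constant. *)
Lemma equivariant_entry (f : k -> k) (m n : int) (d : k) : polynomial_fun f -> f 0 = d ->
    (forall c x, c != 0 -> c ^ m * f x = f (c ^+ 2 * x) * c ^ n) ->
  exists a, [/\ forall x, f x = a * x ^+ `|m - n|./2,
    a != 0 -> (n <= m)%R && ~~ odd `|m - n| & m = n -> a = d].
Proof.
move=> fP f0 fT; have [a nz_a fE] := weight_monomial fP fT.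
exists a; split=> // [/nz_a|eq_mn]; first by lia.
by rewrite -f0 fE eq_mn subrr /= mulr1.
Qed.

Lemma upper_entry al be s i j : weight_rep al be s ->
  exists a, [/\ forall x, s (upper x) i j = a * x ^+ `|wt al be i - wt al be j|./2,
    a != 0 -> (wt al be j <= wt al be i)%R && ~~ odd `|wt al be i - wt al be j|
    & wt al be i = wt al be j -> a = (i == j)%:R].
Proof.
case=> -[sM sR] sT; apply: equivariant_entry => [||c x nz_c].
- exact: (regular_upper i j sR).1.
- by rewrite /upper sl2_1 hom1 //= mxE.
have := congr1 (fun A => slval (s A) i j) (torus_upper x nz_c).
by rewrite !sM /= sT // -diag_wt mul_mx_diag mul_diag_mx !mxE.
Qed.

(** By [torus_lower] the negated weights govern this entry, so a nonzero entry needs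
    [wt al be i <= wt al be j]; together with the hypothesis the two weights agree and the entry is
    constant. *)
Lemma lower_entry al be s i j x : weight_rep al be s ->
  (wt al be j <= wt al be i)%R ->
  s (lower x) i j = (i == j)%:R.
Proof.
case=> -[sM sR] sT le_ji.
have [||c y nz_c|a [lE nz_a a0]] :=
    @equivariant_entry (fun y => s (lower y) i j) (- wt al be i) (- wt al be j) (i == j)%:R.
- exact: (regular_upper i j sR).2.
- by rewrite /lower sl2_1 hom1 //= mxE.
- have := congr1 (fun A => slval (s A) i j) (torus_lower y nz_c).
  rewrite !sM /= sT ?invr_eq0 // -diag_wt mul_mx_diag mul_diag_mx !mxE.
  by rewrite !exprz_inv.
have [eq_w|ne_w] := eqVneq (wt al be i) (wt al be j).
  by rewrite lE a0 ?eq_w // subrr mulr1.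
have -> : s (lower x) i j = 0.
  rewrite lE; have [->|/nz_a] := eqVneq a 0; first by rewrite mul0r.
  by lia.
by case: (eqVneq i j) ne_w => [->|//]; rewrite eqxx.
Qed.

(** The strict inequalities express that entries between distinct basis vectors of equal weight
    vanish. [u14] and [u23] have no parity condition, since their weight differences [2 * al] and
    [2 * be] are even. *)
Definition upper_data al be (u12 u13 u14 u23 u24 u34 : k) :=
  [/\ u12 != 0 -> (be < al)%N /\ ~~ odd (al + be),
      u34 != 0 -> (be < al)%N /\ ~~ odd (al + be),
      u13 != 0 -> (0 < al)%N /\ ~~ odd (al + be),
      u24 != 0 -> (0 < al)%N /\ ~~ odd (al + be) &
      u23 != 0 -> (0 < be)%N].

Lemma upper_shape al be s : (0 < al)%N -> (be <= al)%N -> weight_rep al be s ->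
  exists u12 u13 u14 u23 u24 u34,
    (forall x, slval (s (upper x)) = upper_mx al be u12 u13 u14 u23 u24 u34 x) /\
    upper_data al be u12 u13 u14 u23 u24 u34.
Proof.
move=> al_gt0 le_ba hs.
have E i j (lt_i : (i < 4)%N) (lt_j : (j < 4)%N) := upper_entry (Ordinal lt_i) (Ordinal
  lt_j) hs.
have lt0 i j (lt_i : (i < 4)%N) (lt_j : (j < 4)%N) : (j < i)%N ->
    forall x, s (upper x) (Ordinal lt_i) (Ordinal lt_j) = 0.
  move=> lt_ji x; have [a [-> az aE]] := E i j lt_i lt_j.
  have [->|] := eqVneq a 0; first by rewrite mul0r.
  move=> nz_a; have := az nz_a; rewrite aE ?mul0r.
    by rewrite -val_eqE /= gtn_eqF ?mul0r.
  move: (az nz_a); rewrite /wt /=; clear -le_ba al_gt0 lt_i lt_ji.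
  by case: i lt_i lt_ji => [|[|[|[|//]]]] _; case: j => [|[|[|//]]] //= _; lia.
have dg i (lt_i : (i < 4)%N) : forall x, s (upper x) (Ordinal lt_i) (Ordinal lt_i) = 1.
  by move=> x; have [a [-> _ ->]] := E i i lt_i lt_i; rewrite // subrr eqxx mulr1.
have [u12 [E12 z12 d12]] := E 0%N 1%N isT isT.
have [u13 [E13 z13 d13]] := E 0%N 2%N isT isT.
have [u14 [E14 z14 d14]] := E 0%N 3%N isT isT.
have [u23 [E23 z23 d23]] := E 1%N 2%N isT isT.
have [u24 [E24 z24 d24]] := E 1%N 3%N isT isT.
have [u34 [E34 z34 d34]] := E 2%N 3%N isT isT.
exists u12, u13, u14, u23, u24, u34; split=> [x|].
  rewrite [LHS]mx4_eta !dg
    (lt0 1%N 0%N isT isT isT) (lt0 2%N 0%N isT isT isT) (lt0 2%N 1%N isT isT isT)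
    (lt0 3%N 0%N isT isT isT) (lt0 3%N 1%N isT isT isT) (lt0 3%N 2%N isT isT isT)
    E12 E13 E14 E23 E24 E34 /upper_mx /wt /=.
  have -> : `|(al%:Z - be%:Z)%R|./2 = (al - be)./2 by clear -le_ba; lia.
  have -> : `|(al%:Z - - be%:Z)%R|./2 = (al + be)./2 by clear; lia.
  have -> : `|(al%:Z - - al%:Z)%R|./2 = al by clear; lia.
  have -> : `|(be%:Z - - be%:Z)%R|./2 = be by clear; lia.
  have -> : `|(be%:Z - - al%:Z)%R|./2 = (al + be)./2 by clear; lia.
  by have -> : `|(- be%:Z - - al%:Z)%R|./2 = (al - be)./2 by clear -le_ba; lia.
rewrite /wt /= in d12 d13 d14 d23 d24 d34 z12 z13 z14 z23 z24 z34.
clear -z12 z13 z14 z23 z24 z34 d12 d13 d14 d23 d24 d34 al_gt0.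
split=> nz.
- have [eq|ne] := eqVneq al be; last by move: (z12 nz) ne; clear; lia.
  by move: nz; rewrite d12 ?eq ?eqxx.
- have [eq|ne] := eqVneq al be; last by move: (z34 nz) ne; clear; lia.
  by move: nz; rewrite d34 ?eq ?eqxx.
- by move: al_gt0 (z13 nz); clear; lia.
- by move: al_gt0 (z24 nz); clear; lia.
by rewrite lt0n; apply: contra_neq nz => be0; rewrite d23 // be0.
Qed.

(** The last two clauses are the additional zeros of [lower_entry] between equal weights; they
    supply the missing equations when the Weyl image is not antidiagonal. *)
Lemma bruhat_lower al be s : (be <= al)%N -> weight_rep al be s ->
  exists l21 l31 l32 l41 l42 l43,
  [/\ slval (s (upper 1)) *m s (weyl k) *m s (upper 1) =
      mx4 [:: [:: 1; 0; 0; 0]; [:: l21; 1; 0; 0];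
              [:: l31; l32; 1; 0]; [:: l41; l42; l43; 1]],
      be = 0%N -> l32 = 0 & al = be -> l21 = 0 /\ l43 = 0].
Proof.
move=> le_ba hs; have [[sM _] _] := hs.
have -> : slval (s (upper 1)) *m s (weyl k) *m s (upper 1) = s (lower 1).
  by rewrite lower_bruhat !sM.
have E i j (lt_i : (i < 4)%N) (lt_j : (j < 4)%N) :=
  @lower_entry al be s (Ordinal lt_i) (Ordinal lt_j) 1 hs.
have E' i j (lt_i : (i < 4)%N) (lt_j : (j < 4)%N) : (i <= j)%N ->
    s (lower 1) (Ordinal lt_i) (Ordinal lt_j) = (Ordinal lt_i == Ordinal lt_j)%:R.
  move=> le_ij; apply: E; rewrite /wt /=; clear -le_ba le_ij lt_i lt_j.
  by case: j lt_j le_ij => [|[|[|[|//]]]] _; case: i lt_i => [|[|[|[|//]]]] //= _ _; lia.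
pose L i j (lt_i : (i < 4)%N) (lt_j : (j < 4)%N) := s (lower 1) (Ordinal lt_i) (Ordinal
  lt_j).
exists (L 1%N 0%N isT isT), (L 2%N 0%N isT isT), (L 2%N 1%N isT isT), (L 3%N 0%N isT isT),
  (L 3%N 1%N isT isT), (L 3%N 2%N isT isT).
split.
- by rewrite [LHS]mx4_eta
    (E' 0%N 0%N isT isT isT) (E' 0%N 1%N isT isT isT) (E' 0%N 2%N isT isT isT)
    (E' 0%N 3%N isT isT isT) (E' 1%N 1%N isT isT isT) (E' 1%N 2%N isT isT isT)
    (E' 1%N 3%N isT isT isT) (E' 2%N 2%N isT isT isT) (E' 2%N 3%N isT isT isT)
    (E' 3%N 3%N isT isT isT).
- by move=> be0; rewrite /L E ?/wt //=; clear -le_ba be0; lia.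
move=> al_be; rewrite /L !E ?/wt //=; clear -le_ba al_be; lia.
Qed.

End WeightShapes.

(** * Binomial coefficients modulo p *)

Section Binomials.
Variables (k : fieldType) (p : nat).
Hypothesis hp : p \in [pchar k].

Let p_pr : prime p := pcharf_prime hp.

Lemma frobD (R : comNzRingType) e (x y : R) : p \in [pchar R] ->
  (x + y) ^+ (p ^ e) = x ^+ (p ^ e) + y ^+ (p ^ e).
Proof. by move=> hR; rewrite exprDn_pchar // pnatX pnatE ?(pcharf_prime hR) // hR. Qed.

Lemma coef_X1n (n i : nat) : (('X + 1 : {poly k}) ^+ n)`_i = 'C(n, i)%:R.
Proof.
rewrite exprD1n coef_sum; have [lt_in|le_ni] := ltnP i n.+1.
  rewrite (bigD1 (Ordinal lt_in)) //= coefMn coefXn eqxx big1 ?addr0 // => j ne.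
  by rewrite coefMn coefXn eq_sym (negPf ne : (j : nat) == i = false) mul0rn.
by rewrite bin_small // big1 // => j _;
  rewrite coefMn coefXn gtn_eqF ?mul0rn // (leq_trans _ le_ni).
Qed.

(** Compare coefficients in [('X + 1) ^+ (n * q) = ('X^q + 1) ^+ n] for [q = p ^ e]; a special case
    of Lucas' theorem. *)
Lemma bin_frob n e i :
  'C(n * p ^ e, i)%:R = (if (p ^ e %| i)%N then 'C(n, i %/ p ^ e)%:R else 0) :> k.
Proof.
have q_gt0 : (0 < p ^ e)%N by rewrite expn_gt0 prime_gt0.
rewrite -!coef_X1n -coef_comp_poly_Xn //; congr (_`_i).
rewrite mulnC exprM frobD ?pchar_poly // expr1n.
by rewrite rmorphXn rmorphD /= comp_polyX rmorph1.
Qed.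

(** Write [m = n * q] with [q] the exact power of [p]. Since ['C(m, q) = n] is nonzero in [k], [q]
    must be [i] or [j], so [i = q] and [j = (n - 1) * q]. This leaves [n] equal to 1, 2, 3 or of the
    form [1 + p ^ f]. If [m] is a power of [p], nothing is learnt about [i] and [j]. *)
Lemma binomial_support m i j : (0 < m)%N -> (i <= j)%N -> (i + j = m)%N ->
    (forall n, (0 < n < m)%N -> n != i -> n != j -> 'C(m, n)%:R = 0 :> k) ->
  [\/ exists e, m = (p ^ e)%N,
      exists e, [/\ m = (2 * p ^ e)%N, (2 < p)%N, i = (p ^ e)%N & j = (p ^ e)%N],
      exists e, [/\ m = (3 * p ^ e)%N, (5 <= p)%N, i = (p ^ e)%N & j = (2 * p ^ e)%N] |
      exists e f, [/\ (e < f)%N, m = (p ^ e + p ^ f)%N, i = (p ^ e)%N & j = (p ^ f)%N]].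
Proof.
move=> m_gt0 le_ij ijm C0.
have [n cop_pn mE] := pfactor_coprime p_pr m_gt0.
move: (logn p m) mE => v mE; set q := (p ^ v)%N in mE.
have p_gt1 := prime_gt1 p_pr.
have q_gt0 : (0 < q)%N by rewrite expn_gt0 prime_gt0.
have n_gt0 : (0 < n)%N by case: n mE cop_pn m_gt0 => // ->.
have pn : ~~ (p %| n)%N by rewrite -prime_coprime.
have Cq t : 'C(m, t * q)%:R = 'C(n, t)%:R :> k by rewrite mE bin_frob dvdn_mull // mulnK.
have [n1|n_neq1] := eqVneq n 1%N; first by apply: Or41; exists v; rewrite mE n1 mul1n.
have n_ge2 : (2 <= n)%N by lia.
have lt_qm : (q < m)%N by rewrite mE -[X in (X < _)%N]mul1n ltn_pmul2r.
(* If instead [j = q], then [i <= j] forces [n = 2], and [i = q] all the same. *)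
have iq : i = q.
  have Cm1 : 'C(m, q)%:R != 0 :> k.
    by rewrite -[q]mul1n Cq bin1 -(dvdn_pcharf hp).
  have [//|ne_i] := eqVneq i q.
  have [jq|ne_j] := eqVneq j q; last first.
    by move: Cm1; rewrite C0 ?eqxx ?lt_qm ?q_gt0 // eq_sym.
  have : (n * q <= 2 * q)%N by lia.
  rewrite leq_pmul2r // => n_le2; have n2 : n = 2%N by move: n_ge2 n_le2; clear; lia.
  by move: ijm mE; rewrite n2 jq; clear; lia.
have jq : j = (n.-1 * q)%N by move: ijm; rewrite mE iq -{1}(prednK n_gt0) mulSn => /addnI.
have [n2|n_neq2] := eqVneq n 2%N.
  apply: Or42; exists v; rewrite -/q iq jq mE n2 /= mul1n; split=> //.
  have : p != 2%N by apply: contraNneq pn => ->; rewrite n2.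
  by move: p_gt1; clear; lia.
have [n3|n_neq3] := eqVneq n 3%N.
  (* In characteristic 2 one has [3 * q = q + 2 * q], a sum of two powers of [p]. *)
  have [p2|p_neq2] := eqVneq p 2%N.
    apply: Or44; by exists v, v.+1; rewrite expnS -/q iq jq mE n3 p2 /=; split=> //.
  apply: Or43; exists v; rewrite -/q iq jq mE n3 /=; split=> //.
  move: pn p_gt1 p_neq2 p_pr; rewrite n3; case: p => [|[|[|[|[|r]]]]] //.
have {n_neq2 n_neq3} n_ge4 : (4 <= n)%N by lia.
have lt_tq t : (0 < t < n)%N -> (0 < t * q < m)%N.
  by move=> /andP[t0 tn]; rewrite muln_gt0 t0 q_gt0 mE ltn_pmul2r.
have Cn t : (1 < t < n.-1)%N -> 'C(n, t)%:R = 0 :> k.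
  move=> tn; rewrite -Cq C0 ?lt_tq //; first by lia.
    by rewrite iq -[X in _ != X]mul1n eqn_pmul2r //; lia.
  by rewrite jq eqn_pmul2r //; lia.
(* From [2 * 'C(n, 2) = (n - 1) * n], where [p] divides ['C(n, 2)] but not [n]. *)
have p_n1 : (p %| n.-1)%N.
  have /eqP := Cn 2 ltac:(lia); rewrite -(dvdn_pcharf hp) => pC.
  have : (p %| (n - 1) * 'C(n, 1))%N by rewrite -mul_bin_left dvdn_mull.
  by rewrite bin1 subn1 Euclid_dvdM // (negPf pn) orbF.
have n1_gt0 : (0 < n.-1)%N by lia.
have [n' cop_pn' n1E] := pfactor_coprime p_pr n1_gt0.
have f_gt0 : (0 < logn p n.-1)%N by rewrite logn_gt0 mem_primes p_pr n1_gt0.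
move: (logn p n.-1) f_gt0 n1E => f f_gt0 n1E; set P := (p ^ f)%N in n1E.
have P_gt1 : (1 < P)%N by rewrite -(exp1n f) ltn_exp2r.
have n'_gt0 : (0 < n')%N by case: n' n1E {cop_pn'} => //; lia.
(* By Pascal's rule at [n - 1 = n' * P]: one summand is [n'], prime to [p], and the other vanishes
   because [P] does not divide [P - 1]. *)
have CP : 'C(n, P)%:R != 0 :> k.
  rewrite -(prednK n_gt0) -(prednK (ltnW P_gt1)) binS (prednK (ltnW P_gt1)) natrD n1E.
  rewrite !bin_frob -/P dvdnn divnn (ltnW P_gt1) bin1 ifN ?addr0.
    by rewrite -(dvdn_pcharf hp) -prime_coprime.
  by rewrite gtnNdvd //; lia.
have le_P : (P <= n.-1)%N by rewrite n1E leq_pmull.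
have PE : P = n.-1.
  by apply/eqP; apply: contraNT CP => ne; rewrite Cn //; lia.
apply: Or44; exists v, (f + v)%N; rewrite expnD -/q -/P PE -jq -iq; split=> //.
by lia.
Qed.

End Binomials.

(** * The image of the Weyl element *)

Section WeylElement.
Variable k : closedFieldType.
Implicit Types (s : SL 2 k -> SL 4 k) (x c : k).

Lemma weyl_entry0 al be s i j : weight_rep al be s ->
  wt al be j != - wt al be i -> s (weyl k) i j = 0.
Proof.
case=> -[sM _] sT; apply: contraNeq => nz; apply/eqP.
by apply: weyl_weights sM _ i j nz => c nz_c; rewrite diag_wt sT.
Qed.

Variables (al be : nat) (s : SL 2 k -> SL 4 k) (u12 u13 u14 u23 u24 u34 : k).
Hypotheses (hs : weight_rep al be s)
  (hu : forall x, slval (s (upper x)) = upper_mx al be u12 u13 u14 u23 u24 u34 x).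

Let W i j (lt_i : (i < 4)%N) (lt_j : (j < 4)%N) :=
  s (weyl k) (Ordinal lt_i) (Ordinal lt_j).

(** Four distinct weights make the Weyl image antidiagonal. The equations are entries on and above
    the diagonal of the lower unitriangular matrix of [bruhat_lower]. *)
Lemma weyl_generic : (0 < be < al)%N ->
  exists w1 w2 w3 w4,
    slval (s (weyl k)) = mx4 [:: [:: 0; 0; 0; w1]; [:: 0; 0; w2; 0];
                                 [:: 0; w3; 0; 0]; [:: w4; 0; 0; 0]] /\
    [/\ [/\ u14 * w4 = 1, u13 * w3 + u14 * w4 * u12 = 0,
            u12 * w2 + u13 * w3 * u23 + u14 * w4 * u13 = 0 &
            w1 + u12 * w2 * u34 + u13 * w3 * u24 + u14 * w4 * u14 = 0],
        [/\ u23 * w3 + u24 * w4 * u12 = 1,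
            w2 + u23 * w3 * u23 + u24 * w4 * u13 = 0 &
            w2 * u34 + u23 * w3 * u24 + u24 * w4 * u14 = 0] &
        w3 * u24 + u34 * w4 * u14 = 0].
Proof.
case/andP=> be_gt0 lt_ba.
have WE : slval (s (weyl k)) = mx4
  [:: [:: 0; 0; 0; @W 0 3 isT isT]; [:: 0; 0; @W 1 2 isT isT; 0];
      [:: 0; @W 2 1 isT isT; 0; 0]; [:: @W 3 0 isT isT; 0; 0; 0]].
  rewrite [LHS]mx4_eta; congr mx4.
  congr [:: [:: _; _; _; _]; [:: _; _; _; _]; [:: _; _; _; _]; [:: _; _; _; _]];
    try by []; apply: (weyl_entry0 hs); move: be_gt0 lt_ba; rewrite /wt /=; clear; lia.
move: (@W 0 3 isT isT) (@W 1 2 isT isT) (@W 2 1 isT isT) (@W 3 0 isT isT) WE.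
move=> w1 w2 w3 w4 WE; exists w1, w2, w3, w4; split=> //.
have [l21 [l31 [l32 [l41 [l42 [l43 [LE _ _]]]]]]] := bruhat_lower (ltnW lt_ba) hs.
move: LE; rewrite WE !hu /upper_mx !expr1n !mulr1 !mx4M.
case/mx4_inj => -[e11 e12 e13 e14] [e21 e22 e23 e24] [e31 e32 e33 e34] _.
split; first split; last 1 first; try split;
  [rewrite -[RHS]e34|rewrite -[RHS]e11|rewrite -[RHS]e12|rewrite -[RHS]e13|rewrite -[RHS]e14
  |rewrite -[RHS]e22|rewrite -[RHS]e23|rewrite -[RHS]e24]; ring.
Qed.

(** The weight 0 occurs twice, so a middle block remains unknown; the zero [l32] of [bruhat_lower]
    provides the equation for [m21]. *)
Lemma weyl_middle : be = 0%N -> (0 < al)%N -> u23 = 0 ->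
  exists w1 w4 m11 m12 m21 m22,
    slval (s (weyl k)) = mx4 [:: [:: 0; 0; 0; w1]; [:: 0; m11; m12; 0];
                                 [:: 0; m21; m22; 0]; [:: w4; 0; 0; 0]] /\
    [/\ u14 * w4 = 1,
        w1 + u12 * (m11 * u24 + m12 * u34) + u13 * (m21 * u24 + m22 * u34)
           + u14 * w4 * u14 = 0 &
        [/\ m11 + u24 * w4 * u12 = 1, m12 + u24 * w4 * u13 = 0,
            m21 + u34 * w4 * u12 = 0 & m22 + u34 * w4 * u13 = 1]].
Proof.
move=> be0 al_gt0 u230.
have WE : slval (s (weyl k)) = mx4
  [:: [:: 0; 0; 0; @W 0 3 isT isT]; [:: 0; @W 1 1 isT isT; @W 1 2 isT isT; 0];
      [:: 0; @W 2 1 isT isT; @W 2 2 isT isT; 0]; [:: @W 3 0 isT isT; 0; 0; 0]].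
  rewrite [LHS]mx4_eta; congr mx4.
  congr [:: [:: _; _; _; _]; [:: _; _; _; _]; [:: _; _; _; _]; [:: _; _; _; _]];
    try by []; apply: (weyl_entry0 hs); move: be0 al_gt0; rewrite /wt /=; clear; lia.
move: (@W 0 3 isT isT) (@W 3 0 isT isT) (@W 1 1 isT isT)
  (@W 1 2 isT isT) (@W 2 1 isT isT) (@W 2 2 isT isT) WE.
move=> w1 w4 m11 m12 m21 m22 WE; exists w1, w4, m11, m12, m21, m22; split=> //.
have le_ba : (be <= al)%N by rewrite be0.
have [l21 [l31 [l32 [l41 [l42 [l43 [LE /(_ be0) l32_0 _]]]]]]] := bruhat_lower le_ba hs.
move: LE; rewrite WE !hu /upper_mx !expr1n !mulr1 !mx4M l32_0 u230.
case/mx4_inj => -[e11 e12 e13 e14] [e21 e22 e23 e24] [e31 e32 e33 e34] _.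
split; last split; [rewrite -[RHS]e11|rewrite -[RHS]e14|rewrite -[RHS]e22|rewrite -[RHS]e23
  |rewrite -[RHS]e32|rewrite -[RHS]e33]; ring.
Qed.

(** The first four equations make the upper right block of the unipotent image inverse to the lower
    left block of the Weyl image. *)
Lemma weyl_block : al = be -> (0 < al)%N -> u12 = 0 -> u34 = 0 ->
  exists n11 n12 n21 n22 m11 m12 m21 m22,
    slval (s (weyl k)) = mx4 [:: [:: 0; 0; n11; n12]; [:: 0; 0; n21; n22];
                                 [:: m11; m12; 0; 0]; [:: m21; m22; 0; 0]] /\
    [/\ [/\ u13 * m11 + u14 * m21 = 1, u13 * m12 + u14 * m22 = 0,
            u23 * m11 + u24 * m21 = 0 & u23 * m12 + u24 * m22 = 1] &
        [/\ n11 + (u13 * m11 + u14 * m21) * u13 + (u13 * m12 + u14 * m22) * u23 = 0,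
            n12 + (u13 * m11 + u14 * m21) * u14 + (u13 * m12 + u14 * m22) * u24 = 0,
            n21 + (u23 * m11 + u24 * m21) * u13 + (u23 * m12 + u24 * m22) * u23 = 0 &
            n22 + (u23 * m11 + u24 * m21) * u14 + (u23 * m12 + u24 * m22) * u24 = 0]].
Proof.
move=> al_be al_gt0 u120 u340.
have WE : slval (s (weyl k)) = mx4
  [:: [:: 0; 0; @W 0 2 isT isT; @W 0 3 isT isT]; [:: 0; 0; @W 1 2 isT isT; @W 1 3 isT isT];
      [:: @W 2 0 isT isT; @W 2 1 isT isT; 0; 0]; [:: @W 3 0 isT isT; @W 3 1 isT isT; 0; 0]].
  rewrite [LHS]mx4_eta; congr mx4.
  congr [:: [:: _; _; _; _]; [:: _; _; _; _]; [:: _; _; _; _]; [:: _; _; _; _]];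
    try by []; apply: (weyl_entry0 hs); move: al_be al_gt0; rewrite /wt /=; clear; lia.
move: (@W 0 2 isT isT) (@W 0 3 isT isT) (@W 1 2 isT isT) (@W 1 3 isT isT)
  (@W 2 0 isT isT) (@W 2 1 isT isT) (@W 3 0 isT isT) (@W 3 1 isT isT) WE.
move=> n11 n12 n21 n22 m11 m12 m21 m22 WE; exists n11, n12, n21, n22, m11, m12, m21, m22;
  split=> //.
have le_ba : (be <= al)%N by rewrite al_be.
have [l21 [l31 [l32 [l41 [l42 [l43 [LE _ /(_ al_be)[l210 l430]]]]]]]] := bruhat_lower
  le_ba hs.
move: LE; rewrite WE !hu /upper_mx !expr1n !mulr1 !mx4M l210 u120 u340.
case/mx4_inj => -[e11 e12 e13 e14] [e21 e22 e23 e24] _ _.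
split; split; [rewrite -[RHS]e11|rewrite -[RHS]e12|rewrite -[RHS]e21|rewrite -[RHS]e22
  |rewrite -[RHS]e13|rewrite -[RHS]e14|rewrite -[RHS]e23|rewrite -[RHS]e24]; ring.
Qed.

End WeylElement.

Ltac mx4_entries := congr mx4;
  congr [:: [:: _; _; _; _]; [:: _; _; _; _]; [:: _; _; _; _]; [:: _; _; _; _]].

Definition simp01 := (mul0r, mulr0, add0r, addr0, mul1r, mulr1).

(** * Recovering the forms on the big cell *)

Section StarForms.
Variables (k : closedFieldType) (p : nat).
Hypothesis hp : p \in [pchar k].
Implicit Types (s : SL 2 k -> SL 4 k) (a b c d x : k).

Let p_pr : prime p := pcharf_prime hp.

Lemma frob_gt0 e : (0 < p ^ e)%N.
Proof. by rewrite expn_gt0 prime_gt0. Qed.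

(** Numerals lie in the prime field; this lets the constants of the forms pass through the Frobenius
    twist. *)
Lemma frob_nat e n : (n%:R : k) ^+ (p ^ e) = n%:R.
Proof.
elim: n => [|n IH]; first by rewrite expr0n eqn0Ngt frob_gt0.
by rewrite mulrSr frobD // IH expr1n.
Qed.

Lemma pchar_nat_neq0 n : (0 < n < p)%N -> n%:R != 0 :> k.
Proof.
move=> /andP[n_gt0 lt_np]; rewrite -(dvdn_pcharf hp).
by apply: contraL lt_np => /(dvdn_leq n_gt0); rewrite -leqNgt.
Qed.

Lemma frob_det e a b c d : a * d - b * c = 1 ->
  a ^+ (p ^ e) * d ^+ (p ^ e) - b ^+ (p ^ e) * c ^+ (p ^ e) = 1.
Proof.
move=> dt; have adE : a * d = b * c + 1 by rewrite -dt addrC subrK.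
by rewrite -!exprMn adE frobD // expr1n addrC addKr.
Qed.

(* [field] does not use [m = 0] in characteristic [m], so the quotient of [x - y]
   by [m] has to be given as [z]. *)
Lemma eq_add_mul0 (m x y z : k) : m = 0 -> x = y + m * z -> x = y.
Proof. by move=> -> ->; rewrite mul0r addr0. Qed.

Lemma given_by_cells s (F : k -> k -> k -> k -> 'M[k]_4) :
  {morph s : A B / (A * B)%g} ->
  (forall a b c d, a * d - b * c = 1 -> c != 0 ->
    slval (s (upper (a / c))) *m s (weyl k) *m s (torus c) *m s (upper (d / c))
      = F a b c d) ->
  (forall a b d, a * d = 1 -> a != 0 ->
    slval (s (upper (a * b))) *m s (torus a) = F a b 0 d) ->
  given_by s F.
Proof.
move=> sM F1 F2 A; have dA : A 0 0 * A 1 1 - A 0 1 * A 1 0 = 1.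
  by rewrite -(eqP (slvalP A)) det_mx22.
rewrite {1}[A]sl2_eta; move: (A 0 0) (A 0 1) (A 1 0) (A 1 1) dA => a b c d dA.
have [c0|nz_c] := eqVneq c 0; last by rewrite big_cell // !sM /= (F1 a b c d).
move: dA; rewrite c0 mulr0 subr0 => ad1.
rewrite borel // sM /= (F2 a b d) //; apply: contra_eq_neq ad1 => ->.
by rewrite mul0r eq_sym oner_neq0.
Qed.

Lemma zero_frob e : (0 : k) ^+ (p ^ e) = 0.
Proof. by rewrite expr0n eqn0Ngt frob_gt0. Qed.

(** A Frobenius twist of the symmetric cube: the coefficients are those of the exponential of
    [x ^+ q] times a nilpotent Jordan block. *)
Lemma given_by_formI e (q := (p ^ e)%N) s : (5 <= p)%N -> weight_rep (3 * q) q s ->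
  (forall x, slval (s (upper x)) = upper_mx (3 * q) q 1 2^-1 6^-1 1 2^-1 1 x) ->
  given_by s (formI q).
Proof.
move=> p_ge5 hs hu; have q_gt0 : (0 < q)%N := frob_gt0 e.
have nz2 : 2 != 0 :> k by apply: pchar_nat_neq0; lia.
have nz3 : 3 != 0 :> k by apply: pchar_nat_neq0; lia.
have nz6 : 6 != 0 :> k by rewrite (natrM _ 2 3) mulf_neq0.
have [|w1 [w2 [w3 [w4 [WE [[E11 E12 E13 E14] [E22 E23 E24] _]]]]]] := weyl_generic hs hu.
  by lia.
have w4E : w4 = 6 by apply: (mulfI (invr_neq0 nz6)); rewrite E11 mulVf.
(* The unknown is rewritten as a multiple of the left side of [E12], which vanishes, plus its value;
   [w2] and [w1] are found in the same way. *)
have w3E : w3 = - 2.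
  have -> : w3 = 2 * (2^-1 * w3 + 6^-1 * w4 * 1) - 2 by rewrite w4E; field; rewrite nz2 nz6.
  by rewrite E12; ring.
have w2E : w2 = 2^-1.
  have -> : w2 = (1 * w2 + 2^-1 * w3 * 1 + 6^-1 * w4 / 2) + 2^-1.
    by rewrite w4E w3E; field; rewrite nz2 nz6.
  by rewrite E13 add0r.
have w1E : w1 = - 6^-1.
  have -> : w1 = (w1 + 1 * w2 * 1 + 2^-1 * w3 / 2 + 6^-1 * w4 / 6) - 6^-1.
    by rewrite w4E w3E w2E; field; rewrite nz2 nz6.
  by rewrite E14 add0r.
move: WE; rewrite {}w1E {}w2E {}w3E {}w4E => WE.
have e1 : ((3 * q - q)./2 = q)%N by clear; lia.
have e2 : ((3 * q + q)./2 = 2 * q)%N by clear; lia.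
have X2 (x : k) : x ^+ (2 * q) = (x ^+ q) ^+ 2 by rewrite mulnC exprM.
have X3 (x : k) : x ^+ (3 * q) = (x ^+ q) ^+ 3 by rewrite mulnC exprM.
have [[sM _] sT] := hs.
apply: given_by_cells => // [a b c d dt nz_c|a b d dt nz_a].
  rewrite sT // !hu WE /upper_mx /torus_mx e1 e2 mx4M ?simp01 mx4M ?simp01 mx4M ?simp01
    /formI !X2 !X3.
  (* The [q]-th powers again satisfy the determinant relation, so they replace the entries and the
     twist disappears. Eliminating [b] leaves identities of rational functions. The other forms
     follow this pattern. *)
  rewrite !frobD // !exprMn !exprVn !frob_nat; move: (frob_det e dt) (expf_neq0 q nz_c).
  rewrite -/q; move: (a ^+ q) (b ^+ q) (c ^+ q) (d ^+ q) => {dt nz_c}a {}b {}c {}d dt nz_c.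
  have -> : b = (a * d - 1) / c by rewrite -dt; field.
  rewrite ?simp01.
  by mx4_entries; field; rewrite ?nz2 ?nz6 ?nz_c.
have {dt} -> : d = a^-1 by apply: (mulfI nz_a); rewrite dt divff.
rewrite sT // !hu /upper_mx /torus_mx e1 e2 mx4M /formI !X2 !X3 !exprMn !frobD // !exprMn.
rewrite !exprVn !frob_nat zero_frob; move: (expf_neq0 q nz_a).
move: (a ^+ q) (b ^+ q) => {nz_a}a {}b nz_a.
rewrite ?simp01.
by mx4_entries; field; rewrite ?nz2 ?nz6 ?nz_a.
Qed.

(** The tensor product of two different Frobenius twists of the natural representation. *)
Lemma given_by_formIV e f (q := (p ^ e)%N) (r := (p ^ f)%N) s : (e < f)%N ->
  weight_rep (q + r) (r - q) s ->
  (forall x, slval (s (upper x)) = upper_mx (q + r) (r - q) 1 1 1 0 1 1 x) ->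
  given_by s (formIV q r).
Proof.
move=> lt_ef hs hu; have q_gt0 : (0 < q)%N := frob_gt0 e.
have lt_qr : (q < r)%N by rewrite ltn_exp2l ?prime_gt1.
have [|w1 [w2 [w3 [w4 [WE [[E11 E12 E13 E14] [E22 E23 E24] _]]]]]] := weyl_generic hs hu.
  by lia.
have w4E : w4 = 1 by rewrite -E11 mul1r.
have w3E : w3 = - 1 by apply/eqP; rewrite -subr_eq0 opprK -E12 w4E; apply/eqP; ring.
have w2E : w2 = - 1 by apply/eqP; rewrite -subr_eq0 opprK -E13 w4E; apply/eqP; ring.
have w1E : w1 = 1 by apply/eqP; rewrite -subr_eq0 -E14 w4E w3E w2E; apply/eqP; ring.
move: WE; rewrite {}w1E {}w2E {}w3E {}w4E => WE.
have e1 : ((q + r - (r - q))./2 = q)%N by move: lt_qr; clear; lia.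
have e2 : ((q + r + (r - q))./2 = r)%N by move: lt_qr; clear; lia.
have XB (x : k) : x != 0 -> x ^+ (r - q) = x ^+ r / x ^+ q.
  by move=> nz_x; rewrite expfB_cond // (negPf nz_x) ltnW.
have [[sM _] sT] := hs.
apply: given_by_cells => // [a b c d dt nz_c|a b d dt nz_a].
  rewrite sT // !hu WE /upper_mx /torus_mx e1 e2 mx4M ?simp01 mx4M ?simp01 mx4M ?simp01
    /formIV ?simp01.
  rewrite !XB // !exprD !exprMn !exprVn;
    move: (frob_det e dt) (frob_det f dt) (expf_neq0 q nz_c) (expf_neq0 r nz_c).
  rewrite -/q -/r.
  move: (a ^+ q) (b ^+ q) (c ^+ q) (d ^+ q) (a ^+ r) (b ^+ r) (c ^+ r) (d ^+ r).
  move=> {dt nz_c}a {}b {}c {}d a' b' c' d' dt dt' nz_c nz_c'.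
  have -> : b = (a * d - 1) / c by rewrite -dt; field.
  have -> : b' = (a' * d' - 1) / c' by rewrite -dt'; field.
  by mx4_entries; field; rewrite ?nz_c ?nz_c'.
have {dt} -> : d = a^-1 by apply: (mulfI nz_a); rewrite dt divff.
rewrite sT // !hu /upper_mx /torus_mx e1 e2 mx4M /formIV ?simp01.
rewrite !XB // !exprD !exprMn !exprVn !zero_frob;
  move: (expf_neq0 q nz_a) (expf_neq0 r nz_a).
move: (a ^+ q) (b ^+ q) (a ^+ r) (b ^+ r) => {nz_a}a {}b a' b' nz_a nz_a'.
by mx4_entries; field; rewrite ?nz_a ?nz_a'.
Qed.

(** A nonsplit extension: the first and last basis vectors span a subrepresentation. In [formVII] it
    is the middle two that do. *)
Lemma given_by_formII e (q := (p ^ e)%N) s : p = 3%N -> weight_rep (3 * q) q s ->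
  (forall x, slval (s (upper x)) = upper_mx (3 * q) q 1 2^-1 1 1 0 0 x) ->
  given_by s (formII p q).
Proof.
move=> p3 hs hu; have q_gt0 : (0 < q)%N := frob_gt0 e.
have three0 : 3 = 0 :> k by apply/eqP; rewrite -(dvdn_pcharf hp) p3.
have half : 2^-1 = - 1 :> k.
  have m1 : 2 = - 1 :> k by apply: (eq_add_mul0 (z := 1) three0); ring.
  by rewrite m1 invrN invr1.
have [|w1 [w2 [w3 [w4 [WE [[E11 E12 E13 E14] [E22 E23 E24] E34]]]]]] := weyl_generic hs hu.
  by lia.
rewrite half ?simp01 in E11 E12 E13 E14 E22 E23 E24 E34 hu.
move: WE; rewrite E22 in E23 *; rewrite E11 in E14 *.
move/eqP: E23; rewrite addr_eq0 => /eqP ->; move/eqP: E14; rewrite addr_eq0 => /eqP -> WE.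
have e1 : ((3 * q - q)./2 = q)%N by clear; lia.
have e2 : ((3 * q + q)./2 = 2 * q)%N by clear; lia.
have X2 (x : k) : x ^+ (2 * q) = (x ^+ q) ^+ 2 by rewrite mulnC exprM.
have X3 (x : k) : x ^+ (3 * q) = (x ^+ q) ^+ 3 by rewrite mulnC exprM.
have [[sM _] sT] := hs.
apply: given_by_cells => // [a b c d dt nz_c|a b d dt nz_a].
  rewrite sT // !hu WE /upper_mx /torus_mx e1 e2 mx4M ?simp01 mx4M ?simp01 mx4M ?simp01
    /formII [in X in _ = X]p3 half !X2 !X3.
  rewrite !exprMn !exprVn; move: (frob_det e dt) (expf_neq0 q nz_c).
  rewrite -/q; move: (a ^+ q) (b ^+ q) (c ^+ q) (d ^+ q) => {dt nz_c}a {}b {}c {}d dt nz_c.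
  have -> : b = (a * d - 1) / c by rewrite -dt; field.
  mx4_entries; try (by field; rewrite ?nz_c //).
  - by apply: (eq_add_mul0 (z := - (a ^+ 2 * d) / c ^+ 2) three0); field; rewrite ?nz_c.
  - by apply: (eq_add_mul0 (z := (a ^+ 2 * d ^+ 2 - a * d) / c ^+ 3) three0); field;
    rewrite ?nz_c.
have {dt} -> : d = a^-1 by apply: (mulfI nz_a); rewrite dt divff.
rewrite sT // !hu /upper_mx /torus_mx e1 e2 mx4M /formII [in X in _ = X]p3 half ?simp01
  !X2 !X3 !exprMn.
rewrite !exprVn !zero_frob; move: (expf_neq0 q nz_a).
move: (a ^+ q) (b ^+ q) => {nz_a}a {}b nz_a; rewrite ?simp01.
by mx4_entries; field; rewrite ?nz_a //.
Qed.

(** [formV], [formXI] and [formXIX] differ in whether the row [(u12, u13)] and the column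
    [(u24, u34)] vanish: neither, only the column, or only the row. *)
Lemma given_by_formV e (q := (p ^ e)%N) s : p = 2%N -> weight_rep (2 * q) 0 s ->
  (forall x, slval (s (upper x)) = upper_mx (2 * q) 0 1 0 1 0 0 1 x) ->
  given_by s (formV q).
Proof.
move=> p2 hs hu; have q_gt0 : (0 < q)%N := frob_gt0 e.
have [//||//|w1 [w4 [m11 [m12 [m21 [m22 [WE [E11 E14 [E22 E23 E32 E33]]]]]]]]] :=
  weyl_middle hs hu; first by rewrite muln_gt0.
rewrite ?simp01 in E11 E14 E22 E23 E32 E33.
have two0 : 2 = 0 :> k by apply/eqP; rewrite -(dvdn_pcharf hp) p2.
rewrite E11 in E14 E32; have w1E : w1 = - 1.
  by apply/eqP; rewrite -subr_eq0 opprK -[X in _ == X]E14 E23 ?simp01.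
have m21E : m21 = - 1 by apply/eqP; rewrite -subr_eq0 opprK -[X in _ == X]E32.
move: WE; rewrite w1E E11 E22 E23 m21E E33 => WE.
have e1 : ((2 * q - 0)./2 = q)%N by clear; lia.
have e2 : ((2 * q + 0)./2 = q)%N by clear; lia.
have X2 (x : k) : x ^+ (2 * q) = (x ^+ q) ^+ 2 by rewrite mulnC exprM.
have [[sM _] sT] := hs.
apply: given_by_cells => // [a b c d dt nz_c|a b d dt nz_a].
  rewrite sT // !hu WE /upper_mx /torus_mx e1 e2 !expr0 ?invr1
    mx4M ?simp01 mx4M ?simp01 mx4M ?simp01 /formV !X2.
  rewrite !exprMn !exprVn; move: (frob_det e dt) (expf_neq0 q nz_c).
  rewrite -/q; move: (a ^+ q) (b ^+ q) (c ^+ q) (d ^+ q) => {dt nz_c}a {}b {}c {}d dt nz_c.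
  have -> : b = (a * d - 1) / c by rewrite -dt; field.
  mx4_entries; try (by field; rewrite ?nz_c //).
  - by apply: (eq_add_mul0 (z := a / c) two0); field; rewrite ?nz_c.
  - by apply: (eq_add_mul0 (z := (a * d - 1) / c ^+ 2) two0); field; rewrite ?nz_c.
  - by apply: (eq_add_mul0 (z := d / c) two0); field; rewrite ?nz_c.
have {dt} -> : d = a^-1 by apply: (mulfI nz_a); rewrite dt divff.
rewrite sT // !hu /upper_mx /torus_mx e1 e2 !expr0 ?invr1
  mx4M ?simp01 /formV !X2 !exprMn.
rewrite !exprVn !zero_frob; move: (expf_neq0 q nz_a).
move: (a ^+ q) (b ^+ q) => {nz_a}a {}b nz_a; rewrite ?simp01.
by mx4_entries; field; rewrite ?nz_a //.
Qed.

Lemma given_by_formVII e (q := (p ^ e)%N) s : p = 3%N -> weight_rep (3 * q) q s ->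
  (forall x, slval (s (upper x)) = upper_mx (3 * q) q 0 0 1 1 2^-1 1 x) ->
  given_by s (formVII p q).
Proof.
move=> p3 hs hu; have q_gt0 : (0 < q)%N := frob_gt0 e.
have three0 : 3 = 0 :> k by apply/eqP; rewrite -(dvdn_pcharf hp) p3.
have half : 2^-1 = - 1 :> k.
  have m1 : 2 = - 1 :> k by apply: (eq_add_mul0 (z := 1) three0); ring.
  by rewrite m1 invrN invr1.
have [|w1 [w2 [w3 [w4 [WE [[E11 E12 E13 E14] [E22 E23 E24] E34]]]]]] := weyl_generic hs hu.
  by lia.
rewrite half ?simp01 in E11 E12 E13 E14 E22 E23 E24 E34 hu.
move: WE; rewrite E22 in E23 *; rewrite E11 in E14 *.
move/eqP: E23; rewrite addr_eq0 => /eqP ->; move/eqP: E14; rewrite addr_eq0 => /eqP -> WE.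
have e1 : ((3 * q - q)./2 = q)%N by clear; lia.
have e2 : ((3 * q + q)./2 = 2 * q)%N by clear; lia.
have X2 (x : k) : x ^+ (2 * q) = (x ^+ q) ^+ 2 by rewrite mulnC exprM.
have X3 (x : k) : x ^+ (3 * q) = (x ^+ q) ^+ 3 by rewrite mulnC exprM.
have [[sM _] sT] := hs.
apply: given_by_cells => // [a b c d dt nz_c|a b d dt nz_a].
  rewrite sT // !hu WE /upper_mx /torus_mx e1 e2 mx4M ?simp01 mx4M ?simp01 mx4M ?simp01
    /formVII [in X in _ = X]p3 half !X2 !X3.
  rewrite !exprMn !exprVn; move: (frob_det e dt) (expf_neq0 q nz_c).
  rewrite -/q; move: (a ^+ q) (b ^+ q) (c ^+ q) (d ^+ q) => {dt nz_c}a {}b {}c {}d dt nz_c.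
  have -> : b = (a * d - 1) / c by rewrite -dt; field.
  mx4_entries; try (by field; rewrite ?nz_c //).
  - by apply: (eq_add_mul0 (z := (a ^+ 2 * d ^+ 2 - a * d) / c ^+ 3) three0); field;
    rewrite ?nz_c.
  - by apply: (eq_add_mul0 (z := - (a * d ^+ 2) / c ^+ 2) three0); field; rewrite ?nz_c.
have {dt} -> : d = a^-1 by apply: (mulfI nz_a); rewrite dt divff.
rewrite sT // !hu /upper_mx /torus_mx e1 e2 mx4M /formVII [in X in _ = X]p3 half ?simp01
  !X2 !X3 !exprMn.
rewrite !exprVn !zero_frob; move: (expf_neq0 q nz_a).
move: (a ^+ q) (b ^+ q) => {nz_a}a {}b nz_a; rewrite ?simp01.
by mx4_entries; field; rewrite ?nz_a //.
Qed.

Lemma given_by_formIX e (q := (p ^ e)%N) s : (3 <= p)%N -> weight_rep (2 * q) 0 s ->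
  (forall x, slval (s (upper x)) = upper_mx (2 * q) 0 1 0 2^-1 0 1 0 x) ->
  given_by s (formIX q).
Proof.
move=> p_ge3 hs hu; have q_gt0 : (0 < q)%N := frob_gt0 e.
have [//||//|w1 [w4 [m11 [m12 [m21 [m22 [WE [E11 E14 [E22 E23 E32 E33]]]]]]]]] :=
  weyl_middle hs hu; first by rewrite muln_gt0.
rewrite ?simp01 in E11 E14 E22 E23 E32 E33.
have nz2 : 2 != 0 :> k by apply: pchar_nat_neq0.
have w4E : w4 = 2 by apply: (mulfI (invr_neq0 nz2)); rewrite E11 mulVf.
have m11E : m11 = - 1 by rewrite w4E in E22; apply: (addIr 2); rewrite E22; ring.
have w1E : w1 = 2^-1.
  have -> : w1 = (w1 + m11 + 2^-1 * w4 / 2) + 2^-1 by rewrite w4E m11E; field.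
  by rewrite E14 add0r.
move: WE; rewrite {}w1E {}w4E {}m11E E23 E32 E33 => WE.
have e1 : ((2 * q - 0)./2 = q)%N by clear; lia.
have e2 : ((2 * q + 0)./2 = q)%N by clear; lia.
have X2 (x : k) : x ^+ (2 * q) = (x ^+ q) ^+ 2 by rewrite mulnC exprM.
have [[sM _] sT] := hs.
apply: given_by_cells => // [a b c d dt nz_c|a b d dt nz_a].
  rewrite sT // !hu WE /upper_mx /torus_mx e1 e2 !expr0 ?invr1
    mx4M ?simp01 mx4M ?simp01 mx4M ?simp01 /formIX !X2.
  rewrite !exprMn !exprVn; move: (frob_det e dt) (expf_neq0 q nz_c).
  rewrite -/q; move: (a ^+ q) (b ^+ q) (c ^+ q) (d ^+ q) => {dt nz_c}a {}b {}c {}d dt nz_c.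
  have -> : b = (a * d - 1) / c by rewrite -dt; field.
  by mx4_entries; field; rewrite ?nz2 ?nz_c //.
have {dt} -> : d = a^-1 by apply: (mulfI nz_a); rewrite dt divff.
rewrite sT // !hu /upper_mx /torus_mx e1 e2 !expr0 ?invr1
  mx4M ?simp01 /formIX !X2 !exprMn.
rewrite !exprVn !zero_frob; move: (expf_neq0 q nz_a).
move: (a ^+ q) (b ^+ q) => {nz_a}a {}b nz_a; rewrite ?simp01.
by mx4_entries; field; rewrite ?nz2 ?nz_a //.
Qed.

Lemma given_by_formXI e (q := (p ^ e)%N) s : p = 2%N -> weight_rep (2 * q) 0 s ->
  (forall x, slval (s (upper x)) = upper_mx (2 * q) 0 1 0 1 0 0 0 x) ->
  given_by s (formXI q).
Proof.
move=> p2 hs hu; have q_gt0 : (0 < q)%N := frob_gt0 e.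
have [//||//|w1 [w4 [m11 [m12 [m21 [m22 [WE [E11 E14 [E22 E23 E32 E33]]]]]]]]] :=
  weyl_middle hs hu; first by rewrite muln_gt0.
rewrite ?simp01 in E11 E14 E22 E23 E32 E33.
have two0 : 2 = 0 :> k by apply/eqP; rewrite -(dvdn_pcharf hp) p2.
rewrite E11 in E14; have w1E : w1 = - 1.
  by apply/eqP; rewrite -subr_eq0 opprK -[X in _ == X]E14 ?simp01.
move: WE; rewrite w1E E11 E22 E23 E32 E33 => WE.
have e1 : ((2 * q - 0)./2 = q)%N by clear; lia.
have e2 : ((2 * q + 0)./2 = q)%N by clear; lia.
have X2 (x : k) : x ^+ (2 * q) = (x ^+ q) ^+ 2 by rewrite mulnC exprM.
have [[sM _] sT] := hs.
apply: given_by_cells => // [a b c d dt nz_c|a b d dt nz_a].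
  rewrite sT // !hu WE /upper_mx /torus_mx e1 e2 !expr0 ?invr1
    mx4M ?simp01 mx4M ?simp01 mx4M ?simp01 /formXI !X2.
  rewrite !exprMn !exprVn; move: (frob_det e dt) (expf_neq0 q nz_c).
  rewrite -/q; move: (a ^+ q) (b ^+ q) (c ^+ q) (d ^+ q) => {dt nz_c}a {}b {}c {}d dt nz_c.
  have -> : b = (a * d - 1) / c by rewrite -dt; field.
  mx4_entries; try (by field; rewrite ?nz_c //).
  - by apply: (eq_add_mul0 (z := a / c) two0); field; rewrite ?nz_c.
  - by apply: (eq_add_mul0 (z := (a * d - 1) / c ^+ 2) two0); field; rewrite ?nz_c.
have {dt} -> : d = a^-1 by apply: (mulfI nz_a); rewrite dt divff.
rewrite sT // !hu /upper_mx /torus_mx e1 e2 !expr0 ?invr1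
  mx4M ?simp01 /formXI !X2 !exprMn.
rewrite !exprVn !zero_frob; move: (expf_neq0 q nz_a).
move: (a ^+ q) (b ^+ q) => {nz_a}a {}b nz_a; rewrite ?simp01.
by mx4_entries; field; rewrite ?nz_a //.
Qed.

Lemma given_by_formXV e f (r := (p ^ e)%N) (q := (p ^ f)%N) s : (f <= e)%N -> weight_rep
  r q s ->
  (forall x, slval (s (upper x)) = upper_mx r q 0 0 1 1 0 0 x) ->
  given_by s (formXV r q).
Proof.
move=> le_fe hs hu; have q_gt0 : (0 < q)%N := frob_gt0 f.
have r_gt0 : (0 < r)%N := frob_gt0 e.
have le_qr : (q <= r)%N by rewrite leq_pexp2l ?prime_gt0.
have WE : slval (s (weyl k)) = mx4 [:: [:: 0; 0; 0; - 1]; [:: 0; 0; - 1; 0];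
                                       [:: 0; 1; 0; 0]; [:: 1; 0; 0; 0]].
  (* For [r = q] the weights coincide in pairs and the Weyl image is only known blockwise; the
     equations still give the same matrix. *)
  have [eq_rq|ne_rq] := eqVneq r q.
    have [//|//|//|n11 [n12 [n21 [n22 [m11 [m12 [m21 [m22 [-> [[E1 E2 E3 E4]]]]]]]]]]] :=
      weyl_block hs hu eq_rq.
    rewrite E1 E2 E3 E4 ?simp01 => -[F1 F2 F3 F4]; rewrite ?simp01 in E1 E2 E3 E4.
    rewrite E1 E2 E3 E4 F1 F4; move/eqP: F2; rewrite addr_eq0 => /eqP ->.
    by move/eqP: F3; rewrite addr_eq0 => /eqP ->.
  have [|w1 [w2 [w3 [w4 [-> [[E11 E12 E13 E14] [E22 E23 E24] E34]]]]]] := weyl_generic hs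
    hu.
    by rewrite q_gt0 ltn_neqAle eq_sym ne_rq.
  rewrite ?simp01 in E11 E12 E13 E14 E22 E23 E24 E34.
  rewrite E11 E22 ?simp01 in E14 E23 *.
  move/eqP: E14; rewrite addr_eq0 => /eqP ->.
  by move/eqP: E23; rewrite addr_eq0 => /eqP ->.
have [[sM _] sT] := hs.
apply: given_by_cells => // [a b c d dt nz_c|a b d dt nz_a].
  rewrite sT // !hu WE /upper_mx /torus_mx mx4M ?simp01 mx4M ?simp01 mx4M ?simp01 /formXV
    ?simp01.
  rewrite !exprMn !exprVn; move: (frob_det f dt) (frob_det e dt) (expf_neq0 q nz_c)
    (expf_neq0 r nz_c).
  rewrite -/q -/r.
  move: (a ^+ q) (b ^+ q) (c ^+ q) (d ^+ q) (a ^+ r) (b ^+ r) (c ^+ r) (d ^+ r).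
  move=> {dt nz_c}a {}b {}c {}d a' b' c' d' dt dt' nz_c nz_c'.
  have -> : b = (a * d - 1) / c by rewrite -dt; field.
  have -> : b' = (a' * d' - 1) / c' by rewrite -dt'; field.
  by mx4_entries; field; rewrite ?nz_c ?nz_c'.
have {dt} -> : d = a^-1 by apply: (mulfI nz_a); rewrite dt divff.
rewrite sT // !hu /upper_mx /torus_mx mx4M /formXV ?simp01.
rewrite !exprMn !exprVn !zero_frob; move: (expf_neq0 q nz_a) (expf_neq0 r nz_a).
move: (a ^+ q) (b ^+ q) (a ^+ r) (b ^+ r) => {nz_a}a {}b a' b' nz_a nz_a'.
by mx4_entries; field; rewrite ?nz_a ?nz_a'.
Qed.

Lemma given_by_formXIX e (q := (p ^ e)%N) s : p = 2%N -> weight_rep (2 * q) 0 s ->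
  (forall x, slval (s (upper x)) = upper_mx (2 * q) 0 0 0 1 0 0 1 x) ->
  given_by s (formXIX q).
Proof.
move=> p2 hs hu; have q_gt0 : (0 < q)%N := frob_gt0 e.
have [//||//|w1 [w4 [m11 [m12 [m21 [m22 [WE [E11 E14 [E22 E23 E32 E33]]]]]]]]] :=
  weyl_middle hs hu; first by rewrite muln_gt0.
rewrite ?simp01 in E11 E14 E22 E23 E32 E33.
have two0 : 2 = 0 :> k by apply/eqP; rewrite -(dvdn_pcharf hp) p2.
rewrite E11 in E14; have w1E : w1 = - 1.
  by apply/eqP; rewrite -subr_eq0 opprK -[X in _ == X]E14 ?simp01.
move: WE; rewrite w1E E11 E22 E23 E32 E33 => WE.
have e1 : ((2 * q - 0)./2 = q)%N by clear; lia.
have e2 : ((2 * q + 0)./2 = q)%N by clear; lia.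
have X2 (x : k) : x ^+ (2 * q) = (x ^+ q) ^+ 2 by rewrite mulnC exprM.
have [[sM _] sT] := hs.
apply: given_by_cells => // [a b c d dt nz_c|a b d dt nz_a].
  rewrite sT // !hu WE /upper_mx /torus_mx e1 e2 !expr0 ?invr1
    mx4M ?simp01 mx4M ?simp01 mx4M ?simp01 /formXIX !X2.
  rewrite !exprMn !exprVn; move: (frob_det e dt) (expf_neq0 q nz_c).
  rewrite -/q; move: (a ^+ q) (b ^+ q) (c ^+ q) (d ^+ q) => {dt nz_c}a {}b {}c {}d dt nz_c.
  have -> : b = (a * d - 1) / c by rewrite -dt; field.
  mx4_entries; try (by field; rewrite ?nz_c //).
  - by apply: (eq_add_mul0 (z := (a * d - 1) / c ^+ 2) two0); field; rewrite ?nz_c.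
  - by apply: (eq_add_mul0 (z := d / c) two0); field; rewrite ?nz_c.
have {dt} -> : d = a^-1 by apply: (mulfI nz_a); rewrite dt divff.
rewrite sT // !hu /upper_mx /torus_mx e1 e2 !expr0 ?invr1
  mx4M ?simp01 /formXIX !X2 !exprMn.
rewrite !exprVn !zero_frob; move: (expf_neq0 q nz_a).
move: (a ^+ q) (b ^+ q) => {nz_a}a {}b nz_a; rewrite ?simp01.
by mx4_entries; field; rewrite ?nz_a //.
Qed.

Lemma given_by_formXXIV e (r := (p ^ e)%N) s : weight_rep r 0 s ->
  (forall x, slval (s (upper x)) = upper_mx r 0 0 0 1 0 0 0 x) ->
  given_by s (formXXIV r).
Proof.
move=> hs hu; have r_gt0 : (0 < r)%N := frob_gt0 e.
have [//|//|//|w1 [w4 [m11 [m12 [m21 [m22 [WE [E11 E14 [E22 E23 E32 E33]]]]]]]]] :=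
  weyl_middle hs hu.
rewrite ?simp01 in E11 E14 E22 E23 E32 E33; move/eqP: E14 WE.
rewrite E11 E22 E23 E32 E33 addr_eq0 => /eqP -> WE.
have [[sM _] sT] := hs.
apply: given_by_cells => // [a b c d dt nz_c|a b d dt nz_a].
  rewrite sT // !hu WE /upper_mx /torus_mx !expr0 ?invr1
    mx4M ?simp01 mx4M ?simp01 mx4M ?simp01 /formXXIV.
  rewrite !exprMn !exprVn; move: (frob_det e dt) (expf_neq0 r nz_c).
  rewrite -/r; move: (a ^+ r) (b ^+ r) (c ^+ r) (d ^+ r) => {dt nz_c}a {}b {}c {}d dt nz_c.
  have -> : b = (a * d - 1) / c by rewrite -dt; field.
  by mx4_entries; field; rewrite ?nz_c //.
have {dt} -> : d = a^-1 by apply: (mulfI nz_a); rewrite dt divff.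
rewrite sT // !hu /upper_mx /torus_mx !expr0 ?invr1
  mx4M ?simp01 /formXXIV !exprMn.
rewrite !exprVn !zero_frob; move: (expf_neq0 r nz_a).
move: (a ^+ r) (b ^+ r) => {nz_a}a {}b nz_a; rewrite ?simp01.
by mx4_entries; field; rewrite ?nz_a //.
Qed.

End StarForms.

(** * Change of weight basis and case analysis *)

Section Normalization.
Variables (k : closedFieldType) (p : nat).
Implicit Types (s : SL 2 k -> SL 4 k) (x c : k).

Definition star_equivalent s := exists s',
  [/\ algebraic_group_hom s', equivalent s s' & has_star_form p s'].

Lemma star_equivalent_trans s s' :
  equivalent s s' -> star_equivalent s' -> star_equivalent s.
Proof.
by move=> ss' [t [ht s't tF]]; exists t; split=> //; apply: equivalent_trans ss' s't.
Qed.

(** A [P] commuting with the torus preserves the weights, and the images of the torus and of [upper]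
    suffice to recognise the form, so only [upper] has to be followed through the conjugation. *)
Lemma star_of_conj al be s (P : 'M[k]_4) (M : k -> 'M[k]_4) :
  P \in unitmx -> weight_rep al be s ->
  (forall c, c != 0 -> torus_mx al be c *m P = P *m torus_mx al be c) ->
  (forall x, slval (s (upper x)) *m P = P *m M x) ->
  (forall s', weight_rep al be s' -> (forall x, slval (s' (upper x)) = M x) ->
     has_star_form p s') ->
  star_equivalent s.
Proof.
move=> uP [hs sT] TP UP MF; exists (sl_conj uP \o s); split.
- exact: sl_conj_hom.
- exact: sl_conj_equivalent.
apply: MF => [|x]; last by rewrite /= -mulmxA UP mulKmx.
split=> [|c nz_c]; first exact: sl_conj_hom.
by rewrite /= sT // -mulmxA TP // mulKmx.
Qed.

Lemma unitmx_middle (a1 g22 g23 g32 g33 a4 : k) :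
  a1 != 0 -> a4 != 0 -> g22 * g33 - g23 * g32 != 0 ->
  mx4 [:: [:: a1; 0; 0; 0]; [:: 0; g22; g23; 0]; [:: 0; g32; g33; 0]; [:: 0; 0; 0; a4]]
    \in unitmx.
Proof.
set dt := _ - _ => nz1 nz4 nz_dt.
pose Q : 'M[k]_4 := mx4 [:: [:: a1^-1; 0; 0; 0]; [:: 0; g33 / dt; - g23 / dt; 0];
  [:: 0; - g32 / dt; g22 / dt; 0]; [:: 0; 0; 0; a4^-1]].
have /mulmx1_unit[] // : mx4 [:: [:: a1; 0; 0; 0]; [:: 0; g22; g23; 0];
  [:: 0; g32; g33; 0]; [:: 0; 0; 0; a4]] *m Q = 1%:M.
rewrite /Q mx4M -mx4_1 ?simp01 !divff //; mx4_entries.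
- by apply: (mulIf nz_dt); rewrite mul1r mulrDl !mulrA !divfK //; rewrite /dt; ring.
- by apply: (mulIf nz_dt); rewrite mul0r mulrDl !mulrA !divfK //; ring.
- by apply: (mulIf nz_dt); rewrite mul0r mulrDl !mulrA !divfK //; ring.
- by apply: (mulIf nz_dt); rewrite mul1r mulrDl !mulrA !divfK //; rewrite /dt; ring.
Qed.

Section Scaling.
Variables (al be : nat) (s : SL 2 k -> SL 4 k) (u12 u13 u14 u23 u24 u34 : k).
Hypotheses (hs : weight_rep al be s)
  (hu : forall x, slval (s (upper x)) = upper_mx al be u12 u13 u14 u23 u24 u34 x).
Variables (v12 v13 v14 v23 v24 v34 : k).
Hypothesis star_v : forall s', weight_rep al be s' ->
  (forall x, slval (s' (upper x)) = upper_mx al be v12 v13 v14 v23 v24 v34 x) ->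
  has_star_form p s'.

Lemma star_scale (a1 a2 a3 a4 : k) : a1 != 0 -> a2 != 0 -> a3 != 0 -> a4 != 0 ->
  [/\ u12 * a2 = a1 * v12, u13 * a3 = a1 * v13 & u14 * a4 = a1 * v14] ->
  [/\ u23 * a3 = a2 * v23, u24 * a4 = a2 * v24 & u34 * a4 = a3 * v34] ->
  star_equivalent s.
Proof.
move=> nz1 nz2 nz3 nz4 [E12 E13 E14] [E23 E24 E34].
have nz_dt : a2 * a3 - 0 * 0 != 0 by rewrite mulr0 subr0 mulf_neq0.
apply: (star_of_conj (unitmx_middle nz1 nz4 nz_dt) hs _ _ star_v).
- by move=> c _; rewrite /torus_mx !mx4M ?simp01; mx4_entries; rewrite mulrC.
move=> x; rewrite hu /upper_mx !mx4M ?simp01.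
by mx4_entries; rewrite // ?mulrA -?(E12, E13, E14, E23, E24, E34) mulrAC.
Qed.

(** For [be = 0] the middle block may be any invertible matrix. It acts on the row [(u12, u13)] and
    inversely on the column [(u24, u34)], so the ratio of [u12 * u24 + u13 * u34] to [u14] cannot be
    changed. *)
Lemma star_middle (a1 g22 g23 g32 g33 a4 : k) : be = 0%N -> u23 = 0 -> v23 = 0 ->
  a1 != 0 -> a4 != 0 -> g22 * g33 - g23 * g32 != 0 ->
  [/\ u12 * g22 + u13 * g32 = a1 * v12, u12 * g23 + u13 * g33 = a1 * v13 &
      u14 * a4 = a1 * v14] ->
  u24 * a4 = g22 * v24 + g23 * v34 -> u34 * a4 = g32 * v24 + g33 * v34 ->
  star_equivalent s.
Proof.
move=> be0 u230 v230 nz1 nz4 nz_dt [E12 E13 E14] E24 E34.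
apply: (star_of_conj (unitmx_middle nz1 nz4 nz_dt) hs _ _ star_v).
- move=> c _; rewrite /torus_mx !mx4M ?simp01 be0 expr0 invr1 ?simp01.
  by mx4_entries; rewrite // mulrC.
move=> x; rewrite hu /upper_mx !mx4M ?simp01 be0 subn0 addn0 u230 v230 ?simp01.
mx4_entries; rewrite // ?mulrA -?(E12, E13, E14); try by ring.
- by rewrite mulrAC E24; ring.
- by rewrite mulrAC E34; ring.
Qed.

End Scaling.
End Normalization.

(** * Additivity of the upper unipotent image *)

Section AdditionLaw.
Variable k : closedFieldType.

Lemma binomial_coefs (A B C D E : k) m i j :
  (forall x : k, A * (x + 1) ^+ m = B + C * x ^+ i + D * x ^+ j + E * x ^+ m) ->
  forall n, (0 < n < m)%N ->
    A * 'C(m, n)%:R = C * (n == i)%:R + D * (n == j)%:R.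
Proof.
move=> H n /andP[n_gt0 lt_nm].
have E1 : A *: ('X + 1) ^+ m = B%:P + C *: 'X^i + D *: 'X^j + E *: 'X^m.
  by apply: poly_fun_inj => x _; rewrite !hornerE H.
have := congr1 (fun q : {poly k} => q`_n) E1.
rewrite !(coefD, coefZ, coefC, coefXn, coef_X1n) (gtn_eqF n_gt0) (ltn_eqF lt_nm).
by rewrite ?simp01.
Qed.

Variables (al be : nat) (s : SL 2 k -> SL 4 k) (u12 u13 u14 u23 u24 u34 : k).
Hypotheses (hs : weight_rep al be s)
  (hu : forall x, slval (s (upper x)) = upper_mx al be u12 u13 u14 u23 u24 u34 x).

(** These are the coefficients of [x ^+ n] in the entries of [upper (x + 1) = upper x * upper 1];
    the indicator factors mark the degrees at which the mixed products contribute. *)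
Lemma upper_addition n :
  [/\ (0 < n < al)%N -> u14 * 'C(al, n)%:R =
        u12 * u24 * (n == (al - be)./2)%:R + u13 * u34 * (n == (al + be)./2)%:R,
      (0 < n < (al + be)./2)%N ->
        u13 * 'C((al + be)./2, n)%:R = u12 * u23 * (n == (al - be)./2)%:R,
      (0 < n < (al + be)./2)%N ->
        u24 * 'C((al + be)./2, n)%:R = u23 * u34 * (n == be)%:R &
      (0 < n < be)%N -> u23 * 'C(be, n)%:R = 0].
Proof.
have [[sM _] _] := hs.
have law x : upper_mx al be u12 u13 u14 u23 u24 u34 (x + 1) =
    upper_mx al be u12 u13 u14 u23 u24 u34 x *m upper_mx al be u12 u13 u14 u23 u24 u34 1.
  by rewrite -!hu upperD sM.
have {}law x := mx4_inj (etrans (law x) (mx4M _ _ _ _ _ _ _ _ _ _ _ _ _ _ _ _ _ _ _ _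
   _ _ _ _ _ _ _ _ _ _ _ _)).
split.
- apply: (@binomial_coefs _ u14 _ _ u14) => x; have [[_ _ _ ->] _ _ _] := law x.
  by rewrite !expr1n; ring.
- move=> /(@binomial_coefs u13 u13 (u12 * u23) 0 u13 _ ((al - be)./2) 0) -> => [|x].
    by rewrite mul0r addr0.
  by have [[_ _ -> _] _ _ _] := law x; rewrite !expr1n; ring.
- move=> /(@binomial_coefs u24 u24 (u23 * u34) 0 u24 _ be 0) -> => [|x].
    by rewrite mul0r addr0.
  by have [_ [_ _ _ ->] _ _] := law x; rewrite !expr1n; ring.
move=> /(@binomial_coefs u23 u23 0 0 u23 _ 0 0) -> => [|x].
  by rewrite !mul0r addr0.
by have [_ [_ _ -> _] _ _] := law x; rewrite !expr1n; ring.
Qed.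

End AdditionLaw.

(** * All weights zero, and [be = al] *)

Section ExtremeWeights.
Variables (k : closedFieldType) (p : nat).
Hypothesis hp : p \in [pchar k].
Implicit Types (s : SL 2 k -> SL 4 k).

Let p_pr : prime p := pcharf_prime hp.

Lemma pfrob_inj e f : (p ^ e = p ^ f)%N -> e = f.
Proof. by move/eqP; rewrite eqn_exp2l ?prime_gt1 // => /eqP. Qed.

(** [binomial_support] with [i = 0] and [j = m]; every outcome but the first makes [i] positive. *)
Lemma binomial_pure m : (0 < m)%N ->
  (forall n, (0 < n < m)%N -> 'C(m, n)%:R = 0 :> k) -> exists e, m = (p ^ e)%N.
Proof.
move=> m_gt0 C0; have pos e : (0 < p ^ e)%N by rewrite expn_gt0 prime_gt0.
have [n lt_n _ _|//|[e [_ _ /eqP]]|[e [_ _ /eqP]]|[e [f [_ _ /eqP]]]] :=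
  binomial_support hp m_gt0 (leq0n m) (add0n m); first exact: C0.
all: by rewrite ltn_eqF.
Qed.

(** All weights agree, so both unipotent images are trivial and [lower_bruhat] reduces to triviality
    of the Weyl image. *)
Lemma star_trivial s : weight_rep 0 0 s -> star_equivalent p s.
Proof.
move=> hs; have [[sM sR] sT] := hs.
have w0 i : wt 0 0 i = 0 by case: i => [[|[|[|[|//]]]] ?].
have U1 x : slval (s (upper x)) = 1%:M.
  apply/matrixP => i j; have [a [-> _ aE]] := upper_entry i j hs.
  by rewrite aE !w0 // subrr mulr1 mxE.
have L1 x : slval (s (lower x)) = 1%:M.
  by apply/matrixP => i j; rewrite (lower_entry _ hs) ?w0 // mxE.
have T1 c : c != 0 -> slval (s (torus c)) = 1%:M.
  by move=> nz_c; rewrite sT // /torus_mx !expr0 invr1 mx4_1.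
have W1 : slval (s (weyl k)) = 1%:M.
  by have := congr1 (fun A => slval (s A)) (lower_bruhat k);
    rewrite !sM /= L1 U1 mul1mx mulmx1.
exists s; split; first by split.
  by exists 1%:M; rewrite ?unitmx1 // => A; rewrite invmx1 mul1mx mulmx1.
apply: StarXXVI; apply: given_by_cells => // [a b c d _ nz_c|a b d _ nz_a].
  by rewrite !U1 W1 T1 ?mulmx1.
by rewrite U1 T1 ?mulmx1.
Qed.

Lemma star_equal_weights al s u12 u13 u14 u23 u24 u34 : (0 < al)%N ->
  weight_rep al al s ->
  (forall x, slval (s (upper x)) = upper_mx al al u12 u13 u14 u23 u24 u34 x) ->
  upper_data al al u12 u13 u14 u23 u24 u34 -> star_equivalent p s.
Proof.
move=> al_gt0 hs hu [z12 z34 _ _ _].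
have {z12} u12_0 : u12 = 0 by apply/eqP/negPn/negP => /z12[]; rewrite ltnn.
have {z34} u34_0 : u34 = 0 by apply/eqP/negPn/negP => /z34[]; rewrite ltnn.
subst u12 u34.
have eal : ((al + al)./2 = al)%N by clear; lia.
have [n11 [n12 [n21 [n22 [m11 [m12 [m21 [m22 [_ [[E1 E2 E3 E4] _]]]]]]]]]] :=
  weyl_block hs hu erefl al_gt0 erefl erefl.
(* A nonzero inner binomial coefficient would kill both [u13] and [u14], against [E1]. *)
have [e alE] : exists e, al = (p ^ e)%N.
  apply: binomial_pure => // n lt_n.
  have [+ + _ _] := upper_addition hs hu n; rewrite eal => /(_ lt_n) + /(_ lt_n).
  rewrite ?simp01 => E14 E13; apply/eqP; have := oner_neq0 k.
  apply: contraNT => nz; rewrite -E1.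
  by move/eqP: E14; move/eqP: E13; rewrite !mulf_eq0 (negPf nz) !orbF => /eqP -> /eqP ->;
    rewrite ?simp01.
(* The unipotent block itself, with its columns exchanged because the target has its ones on the
   antidiagonal; the inverse comes from the Weyl image. *)
pose P : 'M[k]_4 := mx4 [:: [:: u14; u13; 0; 0]; [:: u24; u23; 0; 0];
                            [:: 0; 0; 1; 0]; [:: 0; 0; 0; 1]].
have uP : P \in unitmx.
  pose Q : 'M[k]_4 := mx4 [:: [:: m21; m22; 0; 0]; [:: m11; m12; 0; 0];
                              [:: 0; 0; 1; 0]; [:: 0; 0; 0; 1]].
  have /mulmx1_unit[] // : P *m Q = 1%:M.
  by rewrite /P /Q mx4M -mx4_1 ?simp01; mx4_entries; rewrite // addrC ?(E1, E2, E3, E4).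
apply: (star_of_conj (M := upper_mx al al 0 0 1 1 0 0) uP hs).
- by move=> c _; rewrite /P /torus_mx !mx4M ?simp01; mx4_entries; rewrite // mulrC.
- by move=> x; rewrite hu /P /upper_mx eal !mx4M ?simp01; mx4_entries.
move=> s' hs' hu'; apply: (StarXV (e2 := e) (e3 := e)) => //.
by apply: given_by_formXV; rewrite // -alE.
Qed.

End ExtremeWeights.

(** * The weight 0 with multiplicity two *)

Section ZeroWeight.
Variables (k : closedFieldType) (p : nat).
Hypothesis hp : p \in [pchar k].
Variables (al : nat) (s : SL 2 k -> SL 4 k) (u12 u13 u14 u24 u34 : k).
Hypotheses (al_gt0 : (0 < al)%N) (hs : weight_rep al 0 s)
  (hu : forall x, slval (s (upper x)) = upper_mx al 0 u12 u13 u14 0 u24 u34 x)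
  (nz14 : u14 != 0).

Let p_pr : prime p := pcharf_prime hp.

Let u14_binomial n : (0 < n < al)%N ->
  u14 * 'C(al, n)%:R = (u12 * u24 + u13 * u34) * (n == al./2)%:R.
Proof.
move=> lt_n; have [/(_ lt_n) -> _ _ _] := upper_addition hs hu n.
by rewrite subn0 addn0 mulrDl.
Qed.

Lemma star_zero_weight_split : u12 = 0 -> u13 = 0 -> u24 = 0 -> u34 = 0 ->
  star_equivalent p s.
Proof.
move=> z12 z13 z24 z34; have [e alE] : exists e, al = (p ^ e)%N.
  apply: (binomial_pure hp) => // n lt_n; apply: (mulfI nz14).
  by rewrite u14_binomial // z12 z13 ?simp01.
apply: (@star_scale _ p _ _ _ _ _ _ _ _ _ hs hu 0 0 1 0 0 0 _
    u14 1 1 1); rewrite ?oner_neq0 // ?z12 ?z13 ?z24 ?z34 ?simp01 //.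
move=> s'; rewrite alE => hs' hu'; apply: (StarXXIV _ (e2 := e)).
exact: given_by_formXXIV.
Qed.

Lemma star_zero_weight_odd_char e : (2 < p)%N -> al = (2 * p ^ e)%N -> star_equivalent p s.
Proof.
move=> p_gt2 alE; have q_gt0 := frob_gt0 hp e.
have nz2 : 2 != 0 :> k by apply: (pchar_nat_neq0 hp).
have DE : u12 * u24 + u13 * u34 = u14 * 2.
  have <- : 'C(2 * p ^ e, p ^ e)%:R = 2 :> k by rewrite (bin_frob hp) dvdnn divnn q_gt0
    bin1.
  rewrite -alE u14_binomial alE; last by clear -q_gt0; lia.
  by rewrite mul2n doubleK eqxx mulr1.
(* The middle block has as columns [(u24, u34)] and a generator of the kernel of the row
   [(u12, u13)]; the latter becomes the trivial summand. *)
have dtE : u24 * u12 - (- u13) * u34 = u14 * 2 by rewrite -DE; ring.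
apply: (@star_middle _ p _ _ _ _ _ _ _ _ _ hs hu 1 0 2^-1 0 1 0 _
    (u14 * 2) u24 (- u13) u34 u12 1); rewrite ?dtE ?mulf_neq0 ?oner_neq0 // ?simp01 //.
  move=> s'; rewrite alE => hs' hu'; apply: (StarIX (e1 := e)) => //.
  exact: given_by_formIX.
by split; [rewrite -DE|ring|rewrite mulfK].
Qed.

(** The column [(u24, u34)] lies in the kernel of the row [(u12, u13)]. The four cases, by whether
    each of them is zero, give [formXXIV], [formXIX], [formXI] and [formV]. *)
Lemma star_zero_weight_char2 e : p = 2%N -> al = (2 * p ^ e)%N ->
  u12 * u24 + u13 * u34 = 0 -> star_equivalent p s.
Proof.
move=> p2 alE vy0.
have [/andP[/eqP z12 /eqP z13]|nz_v] := boolP ((u12 == 0) && (u13 == 0)).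
  have [/andP[/eqP z24 /eqP z34]|nz_y] := boolP ((u24 == 0) && (u34 == 0)).
    exact: star_zero_weight_split.
  (* Completes the column [(u24, u34)] to a middle block of determinant 1. *)
  have [c1 [c2 cE]] : exists c1 c2, c1 * u34 - u24 * c2 = 1.
    have [z24|nz24] := eqVneq u24 0.
      exists u34^-1, 0; rewrite mulr0 subr0 mulVf //.
      by move: nz_y; rewrite z24 eqxx.
    by exists 0, (- u24^-1); rewrite mul0r sub0r mulrN opprK mulfV.
  apply: (@star_middle _ p _ _ _ _ _ _ _ _ _ hs hu 0 0 1 0 0 1 _
    u14 c1 u24 c2 u34 1);
    rewrite ?cE ?oner_neq0 // ?z12 ?z13 ?simp01 //.
  move=> s'; rewrite alE => hs' hu'; apply: (StarXIX (e1 := e)) => //.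
  exact: given_by_formXIX.
have [c1 [c2 cE]] : exists c1 c2, u12 * c1 + u13 * c2 = u14.
  have [z12|nz12] := eqVneq u12 0.
    exists 0, (u14 / u13); rewrite mulr0 add0r mulrC divfK //.
    by move: nz_v; rewrite z12 eqxx.
  by exists (u14 / u12), 0; rewrite mulr0 addr0 mulrC divfK.
have [/andP[/eqP z24 /eqP z34]|nz_y] := boolP ((u24 == 0) && (u34 == 0)).
  have dtE : c1 * u12 - (- u13) * c2 = u14 by rewrite -cE; ring.
  apply: (@star_middle _ p _ _ _ _ _ _ _ _ _ hs hu 1 0 1 0 0 0 _
    u14 c1 (- u13) c2 u12 1);
    rewrite ?dtE ?oner_neq0 // ?z24 ?z34 ?simp01 //.
    move=> s'; rewrite alE => hs' hu'; apply: (StarXI (e1 := e)) => //.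
    exact: given_by_formXI.
  by split=> //; ring.
(* The kernel of a nonzero row is a line, spanned by [(- u13, u12)]. *)
have [l nz_l [y1 y2]] : exists2 l, l != 0 & u24 = - l * u13 /\ u34 = l * u12.
  have [z12|nz12] := eqVneq u12 0.
    have nz13 : u13 != 0 by move: nz_v; rewrite z12 eqxx.
    have z34 : u34 = 0.
      by apply: (mulfI nz13); rewrite mulr0 -vy0 z12 mul0r add0r.
    exists (- u24 / u13).
      by rewrite mulf_neq0 ?invr_eq0 // oppr_eq0; move: nz_y; rewrite z34 eqxx andbT.
    by rewrite z34 z12 mulr0; split=> //; rewrite mulNr divfK // opprK.
  have y1 : u24 = - (u34 / u12) * u13.
    apply: (mulfI nz12); rewrite -[LHS]addr0; apply/eqP; rewrite -subr_eq0; apply/eqP.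
    by rewrite -[RHS]vy0 addr0; field.
  exists (u34 / u12); last by rewrite divfK.
  rewrite mulf_neq0 ?invr_eq0 //; apply: contra nz_y => /eqP z34.
  by rewrite y1 z34 mul0r oppr0 mul0r eqxx.
have dtE : c1 * u34 - u24 * c2 = l * u14 by rewrite y1 y2 -cE; ring.
apply: (@star_middle _ p _ _ _ _ _ _ _ _ _ hs hu 1 0 1 0 0 1 _
    u14 c1 u24 c2 u34 1);
  rewrite ?dtE ?mulf_neq0 ?oner_neq0 // ?simp01 //.
move=> s'; rewrite alE => hs' hu'; apply: (StarV (e1 := e)) => //.
exact: given_by_formV.
Qed.

Lemma star_zero_weight : upper_data al 0 u12 u13 u14 0 u24 u34 -> star_equivalent p s.
Proof.
move=> [z12 z34 z13 z24 _].
have [odd_al|even_al] := boolP (odd al).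
  have z u : (u != 0 -> (0 < al)%N /\ ~~ odd (al + 0)) -> u = 0.
    by move=> zu; apply/eqP/negPn/negP => /zu[_]; rewrite addn0 odd_al.
  by apply: star_zero_weight_split; apply: z.
have halfE : (al./2 + al./2)%N = al by rewrite addnn even_halfK.
have C0 n : (0 < n < al)%N -> n != al./2 -> n != al./2 -> 'C(al, n)%:R = 0 :> k.
  by move=> lt_n /negPf ne _; apply: (mulfI nz14); rewrite u14_binomial // ne !mulr0.
(* Here [i = j = al./2], which excludes the last two outcomes. An even power of [p] means [p = 2],
   and then the middle binomial coefficient vanishes. *)
case: (binomial_support hp al_gt0 (leqnn _) halfE C0).
- case=> -[|e] alE; first by move: even_al; rewrite alE.
  have p2 : p = 2%N.
    by move: even_al; rewrite alE oddX /= => /negPf; case: (even_prime p_pr) => // ->.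
  apply: (star_zero_weight_char2 (e := e) p2); first by rewrite alE expnS {1}p2.
  have lt_half : (0 < al./2 < al)%N by clear -al_gt0 even_al; lia.
  have := u14_binomial lt_half; rewrite eqxx mulr1 => <-.
  have -> : 'C(al, al./2)%:R = 0 :> k.
    rewrite {1}alE -[(p ^ _)%N]mul1n (bin_frob hp) ifN // -alE.
    by case/andP: lt_half => ? ?; rewrite gtnNdvd.
  by rewrite mulr0.
- by case=> e [alE p_gt2 _ _]; apply: star_zero_weight_odd_char p_gt2 alE.
- case=> e [_ _ ->]; have := frob_gt0 hp e; clear; lia.
by case=> e [f [lt_ef _ -> /(pfrob_inj hp) eq_ef]]; move: lt_ef; rewrite eq_ef ltnn.
Qed.

End ZeroWeight.

(** * Four distinct weights *)

Section DistinctWeights.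
Variables (k : closedFieldType) (p : nat).
Hypothesis hp : p \in [pchar k].
Variables (al be : nat) (s : SL 2 k -> SL 4 k) (u12 u13 u14 u23 u24 u34 : k).
Hypotheses (be_gt0 : (0 < be)%N) (lt_ba : (be < al)%N) (hs : weight_rep al be s)
  (hu : forall x, slval (s (upper x)) = upper_mx al be u12 u13 u14 u23 u24 u34 x)
  (nz14 : u14 != 0).

Let p_pr : prime p := pcharf_prime hp.

(** Additivity in degree [q] gives [3 * u14 = u12 * u24], [2 * u13 = u12 * u23] and
    [2 * u24 = u23 * u34]. All six coefficients are therefore nonzero, and scaling [u12], [u23],
    [u34] to 1 produces the constants 1/2 and 1/6. *)
Lemma star_distinct_cubic e : (5 <= p)%N -> al = (3 * p ^ e)%N -> be = (p ^ e)%N ->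
  star_equivalent p s.
Proof.
move=> p_ge5 alE beE; have q_gt0 := frob_gt0 hp e; set q := (p ^ e)%N in alE beE q_gt0.
have nz2 : 2 != 0 :> k by apply: (pchar_nat_neq0 hp); lia.
have nz3 : 3 != 0 :> k by apply: (pchar_nat_neq0 hp); lia.
have nz6 : 6 != 0 :> k by rewrite (natrM _ 2 3) mulf_neq0.
have e12 : ((al - be)./2 = q)%N by rewrite alE beE; clear; lia.
have e13 : ((al + be)./2 = 2 * q)%N by rewrite alE beE; clear; lia.
have bin n : 'C(n * q, q)%:R = n%:R :> k.
  by rewrite (bin_frob hp) dvdnn divnn q_gt0 bin1.
have neq12 : (q == 2 * q)%N = false by move: q_gt0; clear; lia.
have lt3 : (0 < q < 3 * q)%N by move: q_gt0; clear; lia.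
have lt2 : (0 < q < 2 * q)%N by move: q_gt0; clear; lia.
have [] := upper_addition hs hu q.
rewrite e12 e13 alE beE !bin eqxx neq12 lt2 lt3 mulr0 addr0 !mulr1.
move=> /(_ isT) F14 /(_ isT) F13 /(_ isT) F24 _.
have nz : u12 * u24 != 0 by rewrite -F14 mulf_neq0.
move: nz; rewrite mulf_eq0 negb_or => /andP[nz12 nz24].
have : u23 * u34 != 0 by rewrite -F24 mulf_neq0.
rewrite mulf_eq0 negb_or => /andP[nz23 nz34].
apply: (@star_scale _ p _ _ _ _ _ _ _ _ _ hs hu 1 2^-1 6^-1 1 2^-1 1 _
    (u12 * u23 * u34) (u23 * u34) u34 1); rewrite ?oner_neq0 ?mulf_neq0 //.
- move=> s'; rewrite alE beE => hs' hu'; apply: (StarI (e1 := e)) => //.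
  exact: given_by_formI.
- split; rewrite ?mulr1 ?mulrA //; first by rewrite -F13; field.
  by apply: (mulIf nz6); rewrite divfK // -[in RHS]mulrA -F24 mulrA -F14; ring.
by split; rewrite ?mulr1 //; rewrite -F24; field.
Qed.

(** Degrees [p ^ e] and [p ^ f] give [u14 = u12 * u24 = u13 * u34], all nonzero. Since
    ['C(p ^ f, p ^ e)] vanishes in [k], so does [u12 * u23], hence [u23]. *)
Lemma star_distinct_tensor e f : (e < f)%N -> al = (p ^ e + p ^ f)%N ->
  (al - be)./2 = (p ^ e)%N -> (al + be)./2 = (p ^ f)%N -> star_equivalent p s.
Proof.
move=> lt_ef alE e12 e13; have q_gt0 := frob_gt0 hp e.
have lt_qr : (p ^ e < p ^ f)%N by rewrite ltn_exp2l ?prime_gt1.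
have beE : be = (p ^ f - p ^ e)%N.
  move: alE e12 e13 lt_ba lt_qr; clear.
  by move: (p ^ e)%N (p ^ f)%N => q r; lia.
have Cq : 'C(al, p ^ e)%:R = 1 :> k.
  have -> : al = ((1 + p ^ (f - e)) * p ^ e)%N by rewrite alE mulnDl mul1n -expnD subnK
    // ltnW.
  rewrite (bin_frob hp) dvdnn divnn q_gt0 bin1 natrD natrX.
  by rewrite (pcharf0 hp) expr0n subn_eq0 leqNgt lt_ef addr0.
have Cr : 'C(al, p ^ f)%:R = 1 :> k.
  by rewrite -bin_sub ?alE ?leq_addl // addnK -alE.
have Crq : 'C(p ^ f, p ^ e)%:R = 0 :> k.
  by rewrite -[(p ^ f)%N]mul1n (bin_frob hp) ifN // gtnNdvd.
have [+ + _ _] := upper_addition hs hu (p ^ e).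
rewrite e12 e13 Cq Crq eqxx (ltn_eqF lt_qr) mulr0 addr0 !mulr1 mulr0 q_gt0 /= => F14 F13.
have [+ _ _ _] := upper_addition hs hu (p ^ f).
rewrite e12 e13 Cr eqxx (gtn_eqF lt_qr) mulr0 add0r !mulr1 (ltn_trans q_gt0 lt_qr) /= =>
  F14'.
have lt_qa : (p ^ e < al)%N by rewrite alE -[X in (X < _)%N]addn0 ltn_add2l (ltn_trans
  q_gt0).
have lt_ra : (p ^ f < al)%N by rewrite alE -[X in (X < _)%N]add0n ltn_add2r.
move/(_ lt_qa): F14 => F14; move/(_ lt_ra): F14' => F14'; move/(_ lt_qr): F13 => F13.
have : u12 * u24 != 0 by rewrite -F14.
rewrite mulf_eq0 negb_or => /andP[nz12 nz24].
have : u13 * u34 != 0 by rewrite -F14'.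
rewrite mulf_eq0 negb_or => /andP[nz13 nz34].
have z23 : u23 = 0 by apply: (mulfI nz12); rewrite -F13 mulr0.
apply: (@star_scale _ p _ _ _ _ _ _ _ _ _ hs hu 1 1 1 0 1 1 _
    1 u12^-1 u13^-1 u14^-1); rewrite ?oner_neq0 ?invr_eq0 // ?z23 ?simp01.
- move=> s'; rewrite alE beE => hs' hu'; apply: (StarIV lt_ef).
  exact: given_by_formIV.
- by rewrite !mulfV.
by split=> //; [rewrite F14|rewrite F14']; field; rewrite ?nz12 ?nz24 ?nz13 ?nz34.
Qed.

(** The Weyl equations reduce to [u23 * w3 = 1], [u13 * w3 = - u12] and [w3 * u24 = - u34]. Thus
    [be] is a power of [p], and within each of the pairs [(u12, u13)] and [(u24, u34)] the
    coefficients vanish together. At most one pair survives, and only for [p = 3]: the outcomes are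
    [formXV], [formVII] and [formII]. *)
Lemma star_distinct_frob e (w3 w4 : k) : upper_data al be u12 u13 u14 u23 u24 u34 ->
  al = (p ^ e)%N ->
  u12 * u24 = 0 -> u13 * u34 = 0 ->
  u14 * w4 = 1 -> u13 * w3 + u14 * w4 * u12 = 0 ->
  u23 * w3 + u24 * w4 * u12 = 1 -> w3 * u24 + u34 * w4 * u14 = 0 ->
  star_equivalent p s.
Proof.
move=> [par12 par34 _ _ _] alE z1224 z1334 E11 E12 E22 E34.
have E23 : u23 * w3 = 1 by rewrite -E22 mulrAC [u24 * u12]mulrC z1224 mul0r addr0.
have nz23 : u23 != 0 by apply: contra_eq_neq E23 => ->; rewrite mul0r eq_sym oner_neq0.
have nz3 : w3 != 0 by apply: contra_eq_neq E23 => ->; rewrite mulr0 eq_sym oner_neq0.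
have [f beE] : exists f, be = (p ^ f)%N.
  apply: (binomial_pure hp) => // n lt_n; apply: (mulfI nz23); rewrite mulr0.
  by have [_ _ _ ->] := upper_addition hs hu n.
have lt_fe : (f < e)%N by move: lt_ba; rewrite alE beE ltn_exp2l ?prime_gt1.
have char3 : (al - be)./2 = be -> ~~ odd (al + be) -> p = 3%N /\ al = (3 * p ^ f)%N.
  move=> e12 even_ab; have al3 : al = (3 * p ^ f)%N.
    by rewrite -beE; move: e12 even_ab lt_ba; clear; lia.
  split=> //; move: al3; rewrite alE -{1}(subnK (ltnW lt_fe)) expnD => /eqP.
  rewrite eqn_pmul2r ?(frob_gt0 hp) // => /eqP p3; apply/eqP.
  rewrite -dvdn_prime2 // -p3; apply: dvdn_exp; rewrite ?subn_gt0 //.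
have E12' : u13 * w3 = - u12 by apply/eqP;
  rewrite -addr_eq0 -[u12 in X in X == _]mul1r -E11 E12.
have E34' : w3 * u24 = - u34.
  by apply/eqP; rewrite -addr_eq0 -[u34 in X in X == _]mulr1 -E11 [u14 * w4]mulrC mulrA E34.
have lt_mid : ~~ odd (al + be) -> (0 < (al - be)./2 < (al + be)./2)%N /\
    (0 < be < (al + be)./2)%N /\ ((al + be)./2 - (al - be)./2 = be)%N.
  by move: be_gt0 lt_ba; clear; lia.
(* Degrees [(al - be)./2] and [be] add up to [(al + be)./2], so their binomial coefficients agree.
   If the degrees differed, additivity would make this common value give both zero and [u12 * u23],
   and likewise [u23 * u34]. *)
have e12E : ~~ odd (al + be) ->
    u12 != 0 \/ u34 != 0 -> (al - be)./2 = be.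
  move=> /lt_mid[lt12 [lt_be subE]] nz; apply/eqP; apply: contraT => ne.
  have le12 : ((al - be)./2 <= (al + be)./2)%N by case/andP: lt12 => _ /ltnW.
  have symC : 'C((al + be)./2, (al - be)./2) = 'C((al + be)./2, be).
    by rewrite -(bin_sub le12) subE.
  have [_ /(_ lt12) + /(_ lt12) + _] := upper_addition hs hu (al - be)./2.
  have [_ /(_ lt_be) + /(_ lt_be) + _] := upper_addition hs hu be.
  rewrite symC !eqxx [be == _]eq_sym (negPf ne) !mulr0 !mulr1 => -> + /eqP.
  move=> ->; rewrite eq_sym mulf_eq0 (negPf nz23) orbF => /eqP z12 /eqP.
  by rewrite mulf_eq0 (negPf nz23) /= => z34; case: nz; rewrite ?z12 ?z34 ?eqxx.
have bin2 : (al - be)./2 = be -> ~~ odd (al + be) -> 'C((al + be)./2, be)%:R = 2 :> k.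
  move=> e12 even_ab; have -> : ((al + be)./2 = 2 * be)%N by move: e12 even_ab lt_ba;
    clear; lia.
  by rewrite beE (bin_frob hp) dvdnn divnn (frob_gt0 hp) bin1.
have [z12|nz12] := eqVneq u12 0.
  have z13 : u13 = 0 by apply: (mulIf nz3); rewrite mul0r E12' z12 oppr0.
  have [z34|nz34] := eqVneq u34 0.
    have z24 : u24 = 0 by apply: (mulfI nz3); rewrite mulr0 E34' z34 oppr0.
    apply: (@star_scale _ p _ _ _ _ _ _ _ _ _ hs hu 0 0 1 1 0 0 _ u14 u23 1 1);
      rewrite ?oner_neq0 // ?z12 ?z13 ?z24 ?z34 ?simp01 //.
    move=> s'; rewrite alE beE => hs' hu'; apply: (StarXV (ltnW lt_fe)).
    by apply: given_by_formXV; rewrite // ltnW.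
  have [_ even_ab] := par34 nz34.
  have e12 := e12E even_ab (or_intror nz34); have [p3 alE3] := char3 e12 even_ab.
  have nz2 : 2 != 0 :> k by apply: (pchar_nat_neq0 hp); rewrite p3.
  have [_ [lt_be _]] := lt_mid even_ab.
  have [_ _ /(_ lt_be) + _] := upper_addition hs hu be.
  rewrite bin2 // eqxx mulr1 => F24.
  apply: (@star_scale _ p _ _ _ _ _ _ _ _ _ hs hu 0 0 1 1 2^-1 1 _
    u14 (u23 * u34) u34 1); rewrite ?oner_neq0 ?mulf_neq0 // ?z12 ?z13 ?simp01 //.
    move=> s'; rewrite alE3 beE => hs' hu'; apply: (StarVII (e1 := f)) => //.
    exact: given_by_formVII.
  by split=> //; rewrite -F24 mulfK.
have [_ even_ab] := par12 nz12.
have nz13 : u13 != 0.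
  by apply: contraNneq nz12 => z13; rewrite -oppr_eq0 -E12' z13 mul0r.
have z24 : u24 = 0 by apply: (mulfI nz12); rewrite z1224 mulr0.
have z34 : u34 = 0 by apply: (mulfI nz13); rewrite z1334 mulr0.
have e12 := e12E even_ab (or_introl nz12); have [p3 alE3] := char3 e12 even_ab.
have nz2 : 2 != 0 :> k by apply: (pchar_nat_neq0 hp); rewrite p3.
have [_ [lt_be _]] := lt_mid even_ab.
have [_ /(_ lt_be) + _ _] := upper_addition hs hu be.
rewrite bin2 // e12 eqxx mulr1 => F13.
apply: (@star_scale _ p _ _ _ _ _ _ _ _ _ hs hu 1 2^-1 1 1 0 0 _
    (u12 * u23) u23 1 (u12 * u23 / u14));
  rewrite ?oner_neq0 ?mulf_neq0 ?invr_eq0 // ?z24 ?z34 ?simp01 //.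
- move=> s'; rewrite alE3 beE => hs' hu'; apply: (StarII (e1 := f)) => //.
  exact: given_by_formII.
by split=> //; [rewrite -F13 mulfK|rewrite mulrC divfK].
Qed.

Lemma star_distinct : upper_data al be u12 u13 u14 u23 u24 u34 -> star_equivalent p s.
Proof.
move=> ud; have al_gt0 : (0 < al)%N := leq_ltn_trans (leq0n be) lt_ba.
have [|w1 [w2 [w3 [w4 [_ [[E11 E12 _ _] [E22 _ _] E34]]]]]] := weyl_generic hs hu.
  by rewrite be_gt0.
(* The two mixed products in the [(1, 4)] entry sit in different inner degrees because [be] is
   positive, so each vanishes separately. *)
have frob e : al = (p ^ e)%N -> star_equivalent p s.
  move=> alE; have C0 n : (0 < n < al)%N -> 'C(al, n)%:R = 0 :> k.
    move=> /andP[n_gt0 lt_n]; rewrite {1}alE -[(p ^ e)%N]mul1n (bin_frob hp) ifN //.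
    by rewrite -alE gtnNdvd.
  have [u1 u2 u3 u4 _] := ud.
  have lt12 : u12 != 0 -> (0 < (al - be)./2 < al)%N /\ ((al - be)./2 != (al + be)./2).
    by move/u1=> [_]; move: be_gt0 lt_ba; clear; lia.
  have lt13 : u13 != 0 -> (0 < (al + be)./2 < al)%N /\ ((al + be)./2 != (al - be)./2).
    by move/u3=> [_]; move: be_gt0 lt_ba; clear; lia.
  apply: (star_distinct_frob ud alE _ _ E11 E12 E22 E34).
    have [->|/lt12[lt /negPf ne]] := eqVneq u12 0; first by rewrite mul0r.
    have [/(_ lt) + _ _ _] := upper_addition hs hu (al - be)./2.
    by rewrite C0 // eqxx ne ?simp01.
  have [->|/lt13[lt /negPf ne]] := eqVneq u13 0; first by rewrite mul0r.
  have [/(_ lt) + _ _ _] := upper_addition hs hu (al + be)./2.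
  by rewrite C0 // eqxx ne ?simp01.
(* Odd parity kills [u12], [u13], [u24] and [u34], so no mixed product remains and [al] must be a
   power of [p]. *)
have [odd_ab|even_ab] := boolP (odd (al + be)).
  have z u b : (u != 0 -> b /\ ~~ odd (al + be)) -> u = 0.
    by move=> zu; apply/eqP/negPn/negP => /zu[_]; rewrite odd_ab.
  have [e alE] : exists e, al = (p ^ e)%N; last exact: frob alE.
  case: ud => /z z12 _ /z z13 _ _.
  apply: (binomial_pure hp) => // n lt_n; apply: (mulfI nz14).
  have [/(_ lt_n) -> _ _ _] := upper_addition hs hu n.
  by rewrite z12 z13 ?simp01.
have le_half : ((al - be)./2 <= (al + be)./2)%N by clear; lia.
have halfE : ((al - be)./2 + (al + be)./2)%N = al by move: even_ab lt_ba; clear; lia.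
have C0 n : (0 < n < al)%N -> n != (al - be)./2 -> n != (al + be)./2 -> 'C(al,
  n)%:R = 0 :> k.
  move=> lt_n /negPf ne1 /negPf ne2; apply: (mulfI nz14).
  by have [/(_ lt_n) -> _ _ _] := upper_addition hs hu n; rewrite ne1 ne2 ?simp01.
case: (binomial_support hp al_gt0 le_half halfE C0).
- by case=> e; apply: frob.
(* Equality of the two degrees would mean [be = 0]. *)
- by case=> e [_ _ <-]; move: even_ab be_gt0 lt_ba; clear; lia.
- case=> e [alE p_ge5 e12 e13]; apply: (star_distinct_cubic p_ge5 alE).
  by move: alE e12 e13 lt_ba; clear; move: (p ^ e)%N => q; lia.
by case=> e [f [lt_ef alE e12 e13]]; apply: star_distinct_tensor lt_ef alE e12 e13.
Qed.


End DistinctWeights.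

Theorem theorem5p26 (k : closedFieldType) (p : nat) (hp : p \in [pchar k])
    (sigma : SL 2 k -> SL 4 k) (hsigma : algebraic_group_hom sigma) :
  exists sigma_star : SL 2 k -> SL 4 k,
    [/\ algebraic_group_hom sigma_star,
        equivalent sigma sigma_star
      & has_star_form p sigma_star].
Proof.
have [s [hs sigma_s [al [be [le_ba sT]]]]] := weight_normal_form hsigma.
have {sT}hs : weight_rep al be s by split=> // c nz_c; rewrite sT // diag_wt.
apply: (star_equivalent_trans sigma_s) => {sigma hsigma sigma_s}.
have [al0|al_gt0] := posnP al.
  by move: le_ba hs; rewrite al0 leqn0 => /eqP ->; apply: star_trivial.
have [u12 [u13 [u14 [u23 [u24 [u34 [hu ud]]]]]]] := upper_shape al_gt0 le_ba hs.
have [eq_ba|ne_ba] := eqVneq be al.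
  by rewrite eq_ba in hs hu ud; apply: (star_equal_weights hp al_gt0 hs hu ud).
have lt_ba : (be < al)%N by rewrite ltn_neqAle ne_ba.
(* Both Weyl lemmas below contain [u14 * w4 = 1], the source of the hypothesis that [u14] is
   nonzero. *)
have nz_of_mul1 (u w : k) : u * w = 1 -> u != 0.
  by apply: contra_eq_neq => ->; rewrite mul0r eq_sym oner_neq0.
have [be0|be_gt0] := posnP be; last first.
  have [|w1 [w2 [w3 [w4 [_ [[/nz_of_mul1 nz14 _ _ _] _ _]]]]]] := weyl_generic hs hu.
    by rewrite be_gt0.
  exact: (star_distinct hp be_gt0 lt_ba hs hu nz14 ud).
have u23_0 : u23 = 0 by case: ud => _ _ _ _ z; apply/eqP/negPn/negP => /z; rewrite be0.
have [w1 [w4 [m11 [m12 [m21 [m22 [_ [/nz_of_mul1 nz14 _ _]]]]]]]] :=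
  weyl_middle hs hu be0 al_gt0 u23_0.
by rewrite be0 u23_0 in hs hu ud; apply: (star_zero_weight hp al_gt0 hs hu nz14 ud).
Qed.
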